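(* Let $k$ be a field and let $A$ be a pseudocompact $k$-algebra with Jacobson radical $J=J(A)$. Suppose that the algebra $A/J$ is separable, and let $S_1,S_2$ be two closed subalgebras of $A$ such that $S_1\oplus J(A)=A=S_2\oplus J(A)$. Then there is $\omega\in J$ such that $$S_1=(1-\omega)S_2(1-\omega)^{-1}.$$
   Context: $k$ is a field with the discrete topology. A pseudocompact $k$-algebra is a topological (associative, unital) $k$-algebra that is an inverse limit of discrete finite dimensional $k$-algebras and algebra homomorphisms; equivalently, it has a basis of neighbourhoods of $0$ consisting of ideals of finite codimension whose intersection is $0$, and it is complete. The Jacobson radical $J(A)$ is the intersection of the maximal closed left ideals of $A$ (it is a closed two-sided ideal, coincides with the usual Jacobson radical of $A$ as an abstract algebra, and $1-\omega$ is invertible for every $\omega\in J(A)$). The direct sums are direct sums of $k$-vector spaces. A pseudocompact algebra $B$ is topologically semisimple if for every closed left ideal $I$ of $B$ there is a closed left ideal $L$ with $B=I\oplus L$. A pseudocompact $k$-algebra $B$ is separable if $B\widehat{\otimes}_k E$ is a topologically semisimple algebra over $E$ for every finite extension field $E$ of $k$, where $\widehat{\otimes}_k$ is the completed tensor product (which agrees with $\otimes_k$ here since $E$ is finite dimensional over $k$). *)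

(* Defs.v *)
From HB Require Import structures.
From mathcomp Require Import all_boot all_algebra all_field.
From mathcomp Require Import all_classical topology.

Set Implicit Arguments.
Unset Strict Implicit.
Unset Printing Implicit Defensive.

Import GRing.Theory.

Local Open Scope classical_set_scope.
Local Open Scope ring_scope.
Local Open Scope quotient_scope.

(* The field [k] carries the discrete topology, so the joint continuity of    *)
(* [*:%R] amounts to that of each [c *: _].                                   *)
HB.mixin Record isTopologicalAlgebra (k : fieldType) A
    & Topological A & GRing.Algebra k A := {
  addr_cts : continuous (fun x : A * A => x.1 + x.2) ;
  mulr_cts : continuous (fun x : A * A => x.1 * x.2) ;
  scaler_cts : forall c : k, continuous (fun x : A => c *: x)
}.

#[short(type="topAlgType")]
HB.structure Definition TopologicalAlgebra (k : fieldType) :=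
  {A of Topological A & GRing.Algebra k A & isTopologicalAlgebra k A}.

Section Ideals.
Variables (k : fieldType) (A : topAlgType k).
Implicit Types I L M S : set A.

Definition left_ideal I :=
  [/\ I 0, forall x y, I x -> I y -> I (x + y) & forall a x, I x -> I (a * x)].

Definition ideal I := left_ideal I /\ forall a x, I x -> I (x * a).

Definition finite_codim I := exists (n : nat) (v : 'I_n -> A),
  forall a, exists c : 'I_n -> k, I (a - \sum_i c i *: v i).

Definition subalgebra S := GRing.subalg_closed (mem S).

Definition direct_sum I L :=
  I `&` L = [set 0] /\ [set x + y | x in I & y in L] = setT.

Definition maximal_closed_left_ideal M :=
  [/\ left_ideal M, closed M, M <> setT &
      forall L, left_ideal L -> closed L -> L <> setT -> M `<=` L -> L = M].

Definition jacobson : set A := \bigcap_(M in maximal_closed_left_ideal) M.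

Definition topologically_semisimple := forall I, left_ideal I -> closed I ->
  exists L, [/\ left_ideal L, closed L & direct_sum I L].

End Ideals.
Arguments jacobson {k} A.
Arguments topologically_semisimple {k} A.

(* Completeness is that of the additive group: a filter [F] is Cauchy when    *)
(* [x - y] tends to [0] along [F x F].                                        *)
HB.mixin Record isPseudocompact (k : fieldType) A
    & TopologicalAlgebra k A := {
  pseudocompact_basis : exists B : set (set A),
    [/\ forall I, B I -> ideal I /\ finite_codim I,
        nbhs (0 : A) = filter_from B id &
        \bigcap_(I in B) I = [set 0]] ;
  pseudocompact_complete : forall F : set_system A, ProperFilter F ->
    (fun x : A * A => x.1 - x.2) @ (F, F) --> (0 : A) ->
    exists l : A, F --> l
}.

#[short(type="pseudocompactAlgType")]
HB.structure Definition PseudocompactAlgebra (k : fieldType) :=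
  {A of TopologicalAlgebra k A & isPseudocompact k A}.

HB.mixin Record isRightIdeal (R : nzRingType) (S : R -> bool) := {
  idealrMr : forall a, {in S, forall x, x * a \in S}
}.

(* [idealr] is the library's notion of a proper left ideal. *)
#[short(type="twoSidedIdeal")]
HB.structure Definition TwoSidedIdeal (R : nzRingType) :=
  {S of Idealr R S & isRightIdeal R S}.

Section Continuity.
Variables (k : fieldType) (A : topAlgType k).

Lemma ctsD (T : topologicalType) (f g : T -> A) :
  continuous f -> continuous g -> continuous (fun x => f x + g x).
Proof.
move=> cf cg x; apply: (@continuous_comp _ _ _ (fun x => (f x, g x))
  (fun p : A * A => p.1 + p.2)); last exact: addr_cts.
by apply: cvg_pair; [exact: cf | exact: cg].
Qed.

Lemma ctsM (T : topologicalType) (f g : T -> A) :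
  continuous f -> continuous g -> continuous (fun x => f x * g x).
Proof.
move=> cf cg x; apply: (@continuous_comp _ _ _ (fun x => (f x, g x))
  (fun p : A * A => p.1 * p.2)); last exact: mulr_cts.
by apply: cvg_pair; [exact: cf | exact: cg].
Qed.

Lemma ctsZ (T : topologicalType) (c : k) (f : T -> A) :
  continuous f -> continuous (fun x => c *: f x).
Proof.
move=> cf x; apply: (@continuous_comp _ _ _ f (fun y : A => c *: y)).
  exact: cf.
exact: scaler_cts.
Qed.

Lemma cts_sum (T : topologicalType) (I : Type) (r : seq I) (f : I -> T -> A) :
  (forall i, continuous (f i)) -> continuous (fun x => \sum_(i <- r) f i x).
Proof.
move=> cf; elim: r => [|i r IH].
  have -> : (fun x => \sum_(i <- [::]) f i x) = fun=> 0.
    by apply: funext => x; rewrite big_nil.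
  exact: cst_continuous.
have -> : (fun x => \sum_(j <- i :: r) f j x) =
    fun x => f i x + \sum_(j <- r) f j x.
  by apply: funext => x; rewrite big_cons.
exact: ctsD.
Qed.

Lemma addr_nbhs (x y : A) (U : set A) :
  nbhs (x + y) U -> nbhs x [set z | U (z + y)].
Proof.
move=> UU; have : continuous (fun z : A => z + y).
  by apply: ctsD; [move=> z; exact: cvg_id | exact: cst_continuous].
by move=> /(_ x U); apply.
Qed.

End Continuity.

Definition quot_alg (k : fieldType) (A : topAlgType k) (I : twoSidedIdeal A) :=
  Quotient.quot I.

Section QuotientAlgebra.
Variables (k : fieldType) (A : topAlgType k) (I : twoSidedIdeal A).
Local Notation Q := (quot_alg I).

HB.instance Definition _ := GRing.Zmodule.on Q.
HB.instance Definition _ := EqQuotient.on Q.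

Definition pi_quot (x : A) : Q := \pi_Q x.
Local Notation pi := pi_quot.

Lemma pi_quotP x y : reflect (pi x = pi y) (x - y \in I).
Proof.
by rewrite Quotient.idealrBE; apply: (iffP eqP).
Qed.

Lemma pi_quotK (q : Q) : pi (repr q) = q.
Proof. exact: reprK. Qed.

Lemma pi_quotB : zmod_morphism pi.
Proof. exact: (@raddfB _ _ \pi_(Quotient.quot I)). Qed.

Lemma repr_pi_quot x : repr (pi x) - x \in I.
Proof. by apply/pi_quotP; rewrite pi_quotK. Qed.

HB.instance Definition _ := GRing.isZmodMorphism.Build A Q pi pi_quotB.

Let qone : Q := pi 1.
Let qmul (x y : Q) : Q := pi (repr x * repr y).
Let qscale (c : k) (x : Q) : Q := pi (c *: repr x).

Let qmulE (x y : A) : qmul (pi x) (pi y) = pi (x * y).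
Proof.
apply/pi_quotP; have -> : repr (pi x) * repr (pi y) - x * y =
    (repr (pi x) - x) * repr (pi y) + x * (repr (pi y) - y).
  by rewrite mulrBl mulrBr addrA subrK.
apply: rpredD; first by apply: idealrMr; exact: repr_pi_quot.
by apply: idealMr; exact: repr_pi_quot.
Qed.

Let qscaleE (c : k) (x : A) : qscale c (pi x) = pi (c *: x).
Proof.
apply/pi_quotP.
by rewrite -scalerBr -mulr_algl; apply: idealMr; exact: repr_pi_quot.
Qed.

Let qmulA : associative qmul.
Proof.
move=> x y z; rewrite -[x]pi_quotK -[y]pi_quotK -[z]pi_quotK.
by rewrite !qmulE mulrA.
Qed.

Let qmul1 : left_id qone qmul.
Proof. by move=> x; rewrite -[x]pi_quotK qmulE mul1r. Qed.

Let qmul1r : right_id qone qmul.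
Proof. by move=> x; rewrite -[x]pi_quotK qmulE mulr1. Qed.

Let qmulDl : left_distributive qmul +%R.
Proof.
move=> x y z; rewrite -[x]pi_quotK -[y]pi_quotK -[z]pi_quotK.
by rewrite -raddfD !qmulE mulrDl raddfD.
Qed.

Let qmulDr : right_distributive qmul +%R.
Proof.
move=> x y z; rewrite -[x]pi_quotK -[y]pi_quotK -[z]pi_quotK.
by rewrite -raddfD !qmulE mulrDr raddfD.
Qed.

Let qone_neq0 : qone != 0.
Proof.
apply/eqP; rewrite -[0](raddf0 pi) => /pi_quotP.
by rewrite subr0 idealr1.
Qed.

HB.instance Definition _ := GRing.Zmodule_isNzRing.Build Q
  qmulA qmul1 qmul1r qmulDl qmulDr qone_neq0.

Lemma pi_quot_monoid_morphism : monoid_morphism pi.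
Proof. by split=> // x y; rewrite -[LHS]qmulE. Qed.

HB.instance Definition _ :=
  GRing.isMonoidMorphism.Build A Q pi pi_quot_monoid_morphism.

Let qscaleA a b (v : Q) : qscale a (qscale b v) = qscale (a * b) v.
Proof. by rewrite -[v]pi_quotK !qscaleE scalerA. Qed.

Let qscale1 : left_id 1 qscale.
Proof. by move=> v; rewrite -[v]pi_quotK qscaleE scale1r. Qed.

Let qscaleDr : right_distributive qscale +%R.
Proof.
move=> a u v; rewrite -[u]pi_quotK -[v]pi_quotK.
by rewrite -raddfD !qscaleE scalerDr raddfD.
Qed.

Let qscaleDl v : {morph qscale^~ v : a b / a + b}.
Proof. by move=> a b; rewrite -[v]pi_quotK !qscaleE scalerDl raddfD. Qed.

HB.instance Definition _ := GRing.Zmodule_isLmodule.Build k Q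
  qscaleA qscale1 qscaleDr qscaleDl.

Lemma pi_quotZ : scalable pi.
Proof. by move=> c x; rewrite -[LHS]qscaleE. Qed.

HB.instance Definition _ := GRing.isScalable.Build k A Q *:%R pi pi_quotZ.

Let qscaleAl (a : k) (u v : Q) : a *: (u * v) = a *: u * v.
Proof.
rewrite -[u]pi_quotK -[v]pi_quotK.
by rewrite -rmorphM -!linearZ /= -rmorphM scalerAl.
Qed.

HB.instance Definition _ := GRing.Lmodule_isLalgebra.Build k Q qscaleAl.

Let qscaleAr (a : k) (u v : Q) : a *: (u * v) = u * (a *: v).
Proof.
rewrite -[u]pi_quotK -[v]pi_quotK.
by rewrite -rmorphM -!linearZ /= -rmorphM scalerAr.
Qed.

HB.instance Definition _ := GRing.Lalgebra_isAlgebra.Build k Q qscaleAr.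

Let qopen (U : set Q) := open (pi @^-1` U).

Let qopenT : qopen setT.
Proof. by rewrite /qopen preimage_setT; exact: openT. Qed.

Let qopenI (U V : set Q) : qopen U -> qopen V -> qopen (U `&` V).
Proof. by move=> ? ?; exact: openI. Qed.

Let qopen_bigU (J : Type) (f : J -> set Q) :
  (forall i, qopen (f i)) -> qopen (\bigcup_i f i).
Proof. by move=> oF; apply: bigcup_open => i _; exact: oF. Qed.

HB.instance Definition _ := isOpenTopological.Build Q qopenT qopenI qopen_bigU.

Lemma open_quotE (U : set Q) : open U = open (pi @^-1` U).
Proof. by []. Qed.

Lemma pi_quot_cts : continuous pi.
Proof. exact/continuousP. Qed.

Lemma pi_quot_nbhs (x : A) (U : set A) : nbhs x U -> nbhs (pi x) (pi @` U).
Proof.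
rewrite nbhsE => -[O [oO Ox] OU].
apply: (@filterS _ _ _ (pi @` O)); first exact: image_subset.
apply: open_nbhs_nbhs; split; last by exists x.
rewrite open_quotE openE => y [z Oz zy].
have : nbhs (y + (z - y)) O by rewrite addrC subrK; exact: open_nbhs_nbhs.
move=> /addr_nbhs; apply: filterS => w Ow.
by exists (w + (z - y)) => //; rewrite raddfD raddfB /= zy subrr addr0.
Qed.

Let qcts2 (f : A -> A -> A) (g : Q -> Q -> Q) :
  continuous (fun p : A * A => f p.1 p.2) ->
  (forall x y, pi (f x y) = g (pi x) (pi y)) ->
  continuous (fun p : Q * Q => g p.1 p.2).
Proof.
move=> cf fg [p q] W /=.
rewrite -[p]pi_quotK -[q]pi_quotK -fg => /pi_quot_cts.
move=> /(cf (repr p, repr q)) [[U V] /= [nU nV] UV].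
exists (pi @` U, pi @` V) => /=; first by split; exact: pi_quot_nbhs.
move=> [_ _] /= [[u Uu <-] [v Vv <-]]; rewrite /preimage /= -fg.
exact: (UV (u, v)).
Qed.

Let qaddr_cts : continuous (fun p : Q * Q => p.1 + p.2).
Proof. by apply: (qcts2 (@addr_cts _ A)) => x y; rewrite raddfD. Qed.

Let qmulr_cts : continuous (fun p : Q * Q => p.1 * p.2).
Proof. by apply: (qcts2 (@mulr_cts _ A)) => x y; rewrite rmorphM. Qed.

Let qscaler_cts (c : k) : continuous (fun x : Q => c *: x).
Proof.
apply/continuousP => U oU; rewrite open_quotE.
have -> : pi @^-1` ((fun x : Q => c *: x) @^-1` U) =
    (fun x : A => c *: x) @^-1` (pi @^-1` U).
  by apply/funext => x; rewrite /preimage /= linearZ.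
by move/continuousP: (@scaler_cts _ A c); apply.
Qed.

HB.instance Definition _ := isTopologicalAlgebra.Build k Q
  qaddr_cts qmulr_cts qscaler_cts.

End QuotientAlgebra.

Section Jacobson.
Variables (k : fieldType) (A : pseudocompactAlgType k).
Implicit Types I L M : set A.

Lemma left_idealB L x y : left_ideal L -> L x -> L y -> L (x - y).
Proof. by case=> _ LD LM Lx Ly; apply: LD => //; rewrite -mulN1r; exact: LM. Qed.

Lemma nbhs_left_ideal_closed L : left_ideal L -> nbhs 0 L -> closed L.
Proof.
move=> iL nL x clx.
have /addr_nbhs nLx : nbhs (x + - x) L by rewrite subrr.
have [y [Ly /= Lyx]] := clx _ nLx.
by rewrite -[x](subKr y); exact: left_idealB.
Qed.

Lemma left_ideal_add L I : left_ideal L -> left_ideal I ->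
  left_ideal [set x + y | x in L & y in I].
Proof.
move=> [L0 LD LM] [I0 ID IM]; split.
- by exists 0 => //; exists 0 => //; rewrite addr0.
- move=> _ _ [x Lx [y Iy <-]] [x' Lx' [y' Iy' <-]].
  exists (x + x'); first exact: LD.
  by exists (y + y'); [exact: ID | rewrite addrACA].
- move=> a _ [x Lx [y Iy <-]].
  exists (a * x); first exact: LM.
  by exists (a * y); [exact: IM | rewrite mulrDr].
Qed.

Lemma nbhs_ideal (U : set A) : nbhs 0 U ->
  exists I, [/\ ideal I, nbhs 0 I & I `<=` U].
Proof.
have [B [BI BE _]] := @pseudocompact_basis _ A.
rewrite BE => -[I IB IU]; exists I; split=> //; last by exists I.
by case: (BI _ IB).
Qed.

Lemma maximal_closed_left_ideal_open M : maximal_closed_left_ideal M ->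
  exists I, [/\ ideal I, nbhs 0 I & I `<=` M].
Proof.
move=> [iM cM MT Mmax]; apply: contrapT => noI; apply: MT.
rewrite -subTset => x _; apply: cM => U.
rewrite -[x in nbhs x]add0r => /addr_nbhs nU.
have [I [iI nI IU]] := nbhs_ideal nU.
pose N : set A := [set m + i | m in M & i in I].
have iN : left_ideal N by apply: left_ideal_add => //; case: iI.
have [[M0 _ _] [[I0 _ _] _]] := (iM, iI).
have IN : I `<=` N by move=> i Ii; exists 0 => //; exists i => //; rewrite add0r.
have MN : M `<=` N by move=> m Mm; exists m => //; exists 0 => //; rewrite addr0.
have [NT|NT] := pselect (N = setT).
  have : N x by rewrite NT.
  move=> [m Mm [i Ii mix]]; exists m; split=> //.
  have /IU : I (- i).
    by rewrite -mulN1r; case: iI => -[_ _ IM] _; exact: IM.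
  by rewrite /= -mix [m + i]addrC addKr.
case: noI; exists I; split=> //.
rewrite -(Mmax N) //; apply: nbhs_left_ideal_closed => //.
exact: filterS nI.
Qed.

Lemma jacobson_left_ideal : left_ideal (jacobson A).
Proof.
split.
- by move=> M [[]].
- by move=> x y Jx Jy M mM; have [[_ MD _] _ _ _] := mM; apply: MD;
    [exact: Jx | exact: Jy].
- by move=> a x Jx M mM; have [[_ _ MM] _ _ _] := mM; apply: MM; exact: Jx.
Qed.

Lemma jacobson_mulr (x a : A) : jacobson A x -> jacobson A (x * a).
Proof.
move=> Jx M mM; have [iM cM MT Mmax] := mM; have [M0 MD MM] := iM.
have [Ma|nMa] := pselect (M a); first exact: MM.
have [I [iI nI IM]] := maximal_closed_left_ideal_open mM.
pose P := [set y | M (y * a)].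
have iP : left_ideal P.
  split; rewrite /P /=; first by rewrite mul0r.
    by move=> y z My Mz; rewrite mulrDl; exact: MD.
  by move=> b y My; rewrite -mulrA; exact: MM.
have IP : I `<=` P.
  by move=> i Ii; apply: IM; case: iI => _ IMr; exact: IMr.
suff /Jx : maximal_closed_left_ideal P by [].
split=> //.
- by apply: nbhs_left_ideal_closed => //; exact: filterS nI.
- by move=> PT; have : P 1 by [rewrite PT]; rewrite /P /= mul1r.
move=> L iL cL LT PL; apply/seteqP; split=> // l Ll.
pose La := [set y * a | y in L].
have iLa : left_ideal La.
  case: iL => L0 LD LM; split; first by exists 0 => //; rewrite mul0r.
    move=> _ _ [y Ly <-] [z Lz <-]; exists (y + z); first exact: LD.
    by rewrite mulrDl.
  by move=> b _ [y Ly <-]; exists (b * y); [exact: LM | rewrite mulrA].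
pose N : set A := [set u + m | u in La & m in M].
have iN : left_ideal N by exact: left_ideal_add.
have [La0 _ _] := iLa.
have MN : M `<=` N by move=> m Mm; exists 0 => //; exists m => //; rewrite add0r.
have cN : closed N.
  apply: nbhs_left_ideal_closed => //; apply: filterS nI.
  exact: subset_trans MN.
have [NT|NT] := pselect (N = setT).
  have : N a by rewrite NT.
  move=> [_ [y Ly <-] [m Mm yma]]; case: LT; rewrite -subTset => z _.
  have /PL L1y : P (1 - y).
    by rewrite /P /= mulrBl mul1r -[X in X - _]yma [_ + m]addrC addrK.
  case: iL => _ LD LM; rewrite -[z]mulr1; apply: LM.
  by rewrite -[1](subrK y); exact: LD.
rewrite /P /= -(Mmax N) //; exists (l * a); first by exists l.
by exists 0 => //; rewrite addr0.
Qed.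

Lemma jacobson_proper : ~ jacobson A 1.
Proof.
move=> J1.
have [I [iI nI I1]] : exists I, [/\ ideal I, nbhs (0 : A) I & ~ I 1].
  have [B [BI BE B0]] := @pseudocompact_basis _ A.
  apply: contrapT => noI; suff /eqP : (1 : A) = 0 by rewrite oner_eq0.
  suff : (\bigcap_(I in B) I) (1 : A) by rewrite B0.
  move=> I IB; apply: contrapT => I1; apply: noI; exists I.
  by split=> //; [case: (BI _ IB) | rewrite BE; exists I].
pose P L := left_ideal (I `|` L) /\ ~ (I `|` L) 1.
have [|L [[iL L1] Lmax]] := @Zorn_bigcup A P.
  move=> F FP Ftot; have [I0 ID IM] := iI.1.
  have two x y : (I `|` \bigcup_(X in F) X) x ->
      (I `|` \bigcup_(X in F) X) y ->
      (I x /\ I y) \/ exists X, [/\ F X, (I `|` X) x & (I `|` X) y].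
    move=> [Ix|[X FX Xx]] [Iy|[Y FY Yy]]; first by left.
    - by right; exists Y; split=> //; [left | right].
    - by right; exists X; split=> //; [right | left].
    - have [XY|YX] := Ftot _ _ FX FY.
        by right; exists Y; split=> //; right => //; exact: XY.
      by right; exists X; split=> //; right => //; exact: YX.
  have inF X z : F X -> (I `|` X) z -> (I `|` \bigcup_(X in F) X) z.
    by move=> FX [Iz|Xz]; [left | right; exists X].
  split; first split.
  - by left.
  - move=> x y /two xF /xF [[Ix Iy]|[X [FX Xx Xy]]]; first by left; exact: ID.
    by apply: (inF X) => //; case: (FP _ FX) => -[_ XD _] _; exact: XD.
  - move=> a x [Ix|[X FX Xx]]; first by left; exact: IM.
    apply: (inF X) => //; case: (FP _ FX) => -[_ _ XM] _; apply: XM.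
    by right.
  - by move=> [//|[X FX X1]]; case: (FP _ FX) => _; apply; right.
have cL N : left_ideal N -> I `|` L `<=` N -> closed N.
  move=> iN LN; apply: nbhs_left_ideal_closed => //; apply: filterS nI.
  by move=> i Ii; apply: LN; left.
apply: (L1); apply: J1; split=> //; first exact: cL.
  by move=> LT; apply: L1; rewrite LT.
move=> N iN _ NT LN; apply/seteqP; split=> // n Nn.
have N1 : ~ N 1.
  move=> N1; apply: NT; rewrite -subTset => z _.
  by case: iN => _ _ NM; rewrite -[z]mulr1; exact: NM.
apply: contrapT => nLn; apply: (Lmax N); last first.
  rewrite /P (_ : I `|` N = N) //; apply: setUidr => i Ii.
  by apply: LN; left.
split; first by move=> l Ll; apply: LN; right.
by move=> NL; apply: nLn; right; exact: NL.
Qed.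

Definition jacobson_pred : {pred A} := mem (jacobson A).

Let J_idealr : idealr_closed jacobson_pred.
Proof.
have [J0 JD JM] := jacobson_left_ideal.
split; first by rewrite inE.
  by apply/negP; rewrite inE; exact: jacobson_proper.
by move=> a x y; rewrite !inE => Jx Jy; apply: JD => //; exact: JM.
Qed.

Let J_mulr (a : A) : {in jacobson_pred, forall x, x * a \in jacobson_pred}.
Proof. by move=> x; rewrite !inE; exact: jacobson_mulr. Qed.

HB.instance Definition _ := isIdealr.Build A jacobson_pred J_idealr.
HB.instance Definition _ := isRightIdeal.Build A jacobson_pred J_mulr.

Definition jacobson_quotient : topAlgType k := quot_alg jacobson_pred.

End Jacobson.
Arguments jacobson_pred {k} A.
Arguments jacobson_quotient {k} A.

(* [B] extended to [E]: the tensor product [B (x)_k E], an element of which is *)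
(* the vector of its coordinates along the basis [1 (x) e_i], where the [e_i] *)
(* form the basis [vbasis fullv] of [E] over [k]; [tensor_universal] below is *)
(* the universal property.  As [E] has finite dimension over [k], the product *)
(* topology is that of the completed tensor product: the kernel of            *)
(* [B (x)_k E -> (B / I) (x)_k E] consists of the vectors with entries in [I]. *)
Definition tensor (k : fieldType) (B : topAlgType k) (E : fieldExtType k) :=
  'rV[B]_(\dim {:E}).

Section Tensor.
Variables (k : fieldType) (B : topAlgType k) (E : fieldExtType k).
Local Notation T := (tensor B E).
Local Notation n := (\dim {:E}).
Local Notation e := (tnth (vbasis {:E})).
Local Notation co := (coord (vbasis {:E})).

HB.instance Definition _ := GRing.Zmodule.copy T 'rV[B]_n.
HB.instance Definition _ := Topological.copy T 'rV[B]_n.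

Definition tens (b : B) (u : E) : T := \row_i (co i u *: b).

Lemma co_sum (u : E) : u = \sum_i co i u *: e i.
Proof.
rewrite {1}(coord_vbasis (memvf u)); apply: eq_bigr => i _.
by rewrite (tnth_nth 0).
Qed.

Lemma tensDl u : {morph tens^~ u : b c / b + c}.
Proof. by move=> b c; apply/rowP => i; rewrite !mxE scalerDr. Qed.

Lemma tensDr b : {morph tens b : u v / u + v}.
Proof. by move=> u v; apply/rowP => i; rewrite !mxE linearD scalerDl. Qed.

Lemma tens0l u : tens 0 u = 0.
Proof. by apply/rowP => i; rewrite !mxE scaler0. Qed.

Lemma tens0r b : tens b 0 = 0.
Proof. by apply/rowP => i; rewrite !mxE linear0 scale0r. Qed.

Lemma tensZ c b u : tens (c *: b) u = tens b (c *: u).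
Proof. by apply/rowP => i; rewrite !mxE [co i (_ *: _)]linearZ /= scalerA mulrC. Qed.

Lemma tens_suml (I : Type) (r : seq I) (P : pred I) (f : I -> B) u :
  tens (\sum_(i <- r | P i) f i) u = \sum_(i <- r | P i) tens (f i) u.
Proof. exact: (big_morph (tens^~ u) (tensDl u) (tens0l u)). Qed.

Lemma tens_sumr (I : Type) (r : seq I) (P : pred I) b (f : I -> E) :
  tens b (\sum_(i <- r | P i) f i) = \sum_(i <- r | P i) tens b (f i).
Proof. exact: (big_morph (tens b) (tensDr b) (tens0r b)). Qed.

Lemma tens_sum (x : T) : x = \sum_i tens (x 0 i) (e i).
Proof.
apply/rowP => j; rewrite summxE (bigD1 j) //= mxE.
rewrite (tnth_nth 0) coord_free ?(basis_free (vbasisP _)) // eqxx scale1r.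
rewrite big1 ?addr0 // => i ij; rewrite mxE (tnth_nth 0).
by rewrite coord_free ?(basis_free (vbasisP _)) // (negbTE ij) scale0r.
Qed.

Lemma tensor_ind (P : T -> Prop) : (forall b u, P (tens b u)) ->
  (forall x y, P x -> P y -> P (x + y)) -> forall x, P x.
Proof.
move=> Pt PD x; rewrite [x]tens_sum; apply: (big_ind P) => //.
by rewrite -(tens0l 0).
Qed.

Lemma tensor_universal (M : lmodType k) (f : B -> E -> M) :
  (forall b, linear (f b)) -> (forall u, linear (f^~ u)) ->
  exists! h : T -> M, zmod_morphism h /\ forall b u, h (tens b u) = f b u.
Proof.
move=> fr fl.
have f0 u : f 0 u = 0.
  by have := fl u (-1) 0 0; rewrite /= !scaleN1r !addNr.
have f0r b : f b 0 = 0.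
  by have := fr b (-1) 0 0; rewrite !scaleN1r !addNr.
pose h (x : T) := \sum_i f (x 0 i) (e i).
have fB u b c : f (b - c) u = f b u - f c u.
  by rewrite -[- c]scaleN1r [b + _]addrC fl scaleN1r addrC.
exists h; split; first split.
- move=> x y; rewrite /h -sumrB; apply: eq_bigr => i _.
  by rewrite !mxE fB.
- move=> b u; rewrite /h [in RHS](co_sum u).
  have fZ c i : f (c *: b) (e i) = f b (c *: e i).
    by have := fl (e i) c b 0; have := fr b c (e i) 0;
       rewrite !addr0 f0 f0r !addr0 => -> ->.
  have fD : {morph f b : v w / v + w}.
    by move=> v w; have := fr b 1 v w; rewrite !scale1r.
  rewrite (big_morph (f b) fD (f0r b)); apply: eq_bigr => i _.
  by rewrite mxE fZ.
move=> g [gB gt]; apply/funext => x.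
have g0 : g 0 = 0 by rewrite -(subrr 0) gB subrr.
have gD : {morph g : v w / v + w}.
  move=> v w; rewrite -[w in LHS]opprK gB -[- w]sub0r gB g0 sub0r.
  by rewrite opprK.
rewrite [x in RHS]tens_sum (big_morph g gD g0).
by apply: eq_bigr => i _; rewrite gt.
Qed.

Let tone : T := tens 1 1.
Let tmul (x y : T) : T := \sum_i \sum_j tens (x 0 i * y 0 j) (e i * e j).
Let tscale (a : E) (x : T) : T := \sum_i tens (x 0 i) (a * e i).

Let tmulE b u c v : tmul (tens b u) (tens c v) = tens (b * c) (u * v).
Proof.
rewrite /tmul [in RHS](co_sum u) [in RHS](co_sum v) mulr_suml tens_sumr.
apply: eq_bigr => i _; rewrite mulr_sumr tens_sumr; apply: eq_bigr => j _.
by rewrite !mxE -!scalerAl -!scalerAr !tensZ !scalerA [co j v * _]mulrC.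
Qed.

Let tmulDl : left_distributive tmul +%R.
Proof.
move=> x y z; rewrite /tmul -big_split; apply: eq_bigr => i _.
rewrite -big_split; apply: eq_bigr => j _.
by rewrite mxE mulrDl tensDl.
Qed.

Let tmulDr : right_distributive tmul +%R.
Proof.
move=> x y z; rewrite /tmul -big_split; apply: eq_bigr => i _.
rewrite -big_split; apply: eq_bigr => j _.
by rewrite mxE mulrDr tensDl.
Qed.

Let tmulA : associative tmul.
Proof.
elim/tensor_ind => [b u|x x' IH IH'] y z; last by rewrite !tmulDl IH IH'.
elim/tensor_ind: y z => [c v|y y' IH IH'] z; last first.
  by rewrite !(tmulDl, tmulDr) IH IH'.
elim/tensor_ind: z => [d w|z z' IH IH']; last by rewrite !tmulDr IH IH'.
by rewrite !tmulE !mulrA.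
Qed.

Let tmul1 : left_id tone tmul.
Proof.
elim/tensor_ind => [b u|x y IH IH']; last by rewrite tmulDr IH IH'.
by rewrite tmulE !mul1r.
Qed.

Let tmul1r : right_id tone tmul.
Proof.
elim/tensor_ind => [b u|x y IH IH']; last by rewrite tmulDl IH IH'.
by rewrite tmulE !mulr1.
Qed.

Let tone_neq0 : tone != 0.
Proof.
apply/eqP => /rowP t0; have /eqP : (1 : E) = 0; last by rewrite oner_eq0.
rewrite (co_sum 1) big1 // => i _.
have := t0 i; rewrite !mxE; have [->|ci0] := eqVneq (co i 1) 0.
  by rewrite !scale0r.
move=> /(congr1 (fun b => (co i 1)^-1 *: b)).
rewrite scalerA mulVf // scale1r scaler0 => /eqP.
by rewrite oner_eq0.
Qed.

HB.instance Definition _ := GRing.Zmodule_isNzRing.Build T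
  tmulA tmul1 tmul1r tmulDl tmulDr tone_neq0.

Lemma tens1 : tens 1 1 = 1.
Proof. by []. Qed.

Lemma tensM b u c v : tens b u * tens c v = tens (b * c) (u * v).
Proof. exact: tmulE. Qed.

Let tscaleE a b u : tscale a (tens b u) = tens b (a * u).
Proof.
rewrite /tscale [in RHS](co_sum u) mulr_sumr tens_sumr.
by apply: eq_bigr => i _; rewrite mxE tensZ scalerAr.
Qed.

Let tscaleDr : right_distributive tscale +%R.
Proof.
move=> a x y; rewrite /tscale -big_split; apply: eq_bigr => i _.
by rewrite mxE tensDl.
Qed.

Let tscaleDl x : {morph tscale^~ x : a b / a + b}.
Proof.
move=> a b; rewrite /tscale -big_split; apply: eq_bigr => i _.
by rewrite mulrDl tensDr.
Qed.

Let tscaleA a b x : tscale a (tscale b x) = tscale (a * b) x.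
Proof.
elim/tensor_ind: x => [c u|x y IH IH']; last by rewrite !tscaleDr IH IH'.
by rewrite !tscaleE mulrA.
Qed.

Let tscale1 : left_id 1 tscale.
Proof.
elim/tensor_ind => [c u|x y IH IH']; last by rewrite !tscaleDr IH IH'.
by rewrite tscaleE mul1r.
Qed.

HB.instance Definition _ := GRing.Zmodule_isLmodule.Build E T
  tscaleA tscale1 tscaleDr tscaleDl.

Lemma scale_tens (a : E) b u : a *: tens b u = tens b (a * u).
Proof. exact: tscaleE. Qed.

Let tscaleAl (a : E) (x y : T) : a *: (x * y) = a *: x * y.
Proof.
elim/tensor_ind: x => [c u|x x' IH IH']; last first.
  by rewrite mulrDl !scalerDr mulrDl IH IH'.
elim/tensor_ind: y => [d v|y y' IH IH']; last first.
  by rewrite !mulrDr scalerDr IH IH'.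
by rewrite !(tensM, scale_tens) mulrA.
Qed.

HB.instance Definition _ := GRing.Lmodule_isLalgebra.Build E T tscaleAl.

Let tscaleAr (a : E) (x y : T) : a *: (x * y) = x * (a *: y).
Proof.
elim/tensor_ind: x => [c u|x x' IH IH']; last first.
  by rewrite !mulrDl !scalerDr IH IH'.
elim/tensor_ind: y => [d v|y y' IH IH']; last first.
  by rewrite !(mulrDr, scalerDr) IH IH'.
by rewrite !(tensM, scale_tens) mulrCA.
Qed.

HB.instance Definition _ := GRing.Lalgebra_isAlgebra.Build E T tscaleAr.

Lemma tensor_coord_cts i : continuous (fun x : T => x 0 i).
Proof.
move=> x U /= nU.
exists (fun r j => if j == i then U else setT) => [r j|y /(_ 0 i)].
  case: eqP => [->|_]; last exact: filterT.
  by rewrite (ord1 r).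
by rewrite /= eqxx.
Qed.

Lemma tensor_cts (X : topologicalType) (f : X -> T) :
  (forall i, continuous (fun x => f x 0 i)) -> continuous f.
Proof.
move=> cf x U [P nP PU].
have : \forall y \near x, forall i, P 0 i (f y 0 i).
  apply: filter_forall => i; exact: (cf i x (P 0 i) (nP 0 i)).
by apply: filterS => y Py; apply: PU => r i; rewrite (ord1 r).
Qed.

Let coord1_cts i : continuous (fun p : T * T => (p.1 : T) 0 i).
Proof.
move=> p; apply: (@continuous_comp _ _ _ fst (fun x : T => x 0 i)).
  exact: cvg_fst.
exact: tensor_coord_cts.
Qed.

Let coord2_cts i : continuous (fun p : T * T => (p.2 : T) 0 i).
Proof.
move=> p; apply: (@continuous_comp _ _ _ snd (fun x : T => x 0 i)).
  exact: cvg_snd.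
exact: tensor_coord_cts.
Qed.

Let tadd_cts : continuous (fun p : T * T => p.1 + p.2).
Proof.
apply: tensor_cts => i.
have -> : (fun p : T * T => (p.1 + p.2) 0 i) =
    (fun p => (p.1 : T) 0 i + (p.2 : T) 0 i).
  by apply/funext => p; rewrite mxE.
exact: ctsD.
Qed.

Let tmul_cts : continuous (fun p : T * T => p.1 * p.2).
Proof.
apply: tensor_cts => l.
have -> : (fun p : T * T => (p.1 * p.2) 0 l) =
    (fun p => \sum_i \sum_j co l (e i * e j) *: ((p.1 : T) 0 i * (p.2 : T) 0 j)).
  apply/funext => p; rewrite [p.1 * p.2]/(tmul _ _) summxE.
  apply: eq_bigr => i _; rewrite summxE; apply: eq_bigr => j _.
  by rewrite mxE.
by apply: cts_sum => i; apply: cts_sum => j; apply: ctsZ; exact: ctsM.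
Qed.

Let tscale_cts (a : E) : continuous (fun x : T => a *: x).
Proof.
apply: tensor_cts => l.
have -> : (fun x : T => (a *: x) 0 l) =
    (fun x => \sum_i co l (a * e i) *: (x : T) 0 i).
  apply/funext => x; rewrite [a *: x]/(tscale _ _) summxE.
  by apply: eq_bigr => i _; rewrite mxE.
by apply: cts_sum => i; apply: ctsZ; exact: tensor_coord_cts.
Qed.

HB.instance Definition _ := isTopologicalAlgebra.Build E T
  tadd_cts tmul_cts tscale_cts.

End Tensor.
Arguments tensor {k} B E.

Definition separable_algebra (k : fieldType) (B : topAlgType k) :=
  forall E : fieldExtType k, topologically_semisimple (tensor B E).

(* Main.v *)
Require Import Defs.
From HB Require Import structures.
From mathcomp Require Import all_boot all_algebra all_field.
From mathcomp Require Import all_classical topology.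

(** Let s1, s2 : A -> A be the projections onto S1 and S2 along J; they are
    morphisms of algebras that factor through A / J and agree modulo J. It
    suffices to find u in 1 + J with s1(a) u = u s2(a) for all a, since such a
    u is invertible (jacobson_unit).

    If A / J were finite-dimensional, it would have a separability element, that
    is a tensor sum_i x_i (x) y_i with sum_i x_i y_i = 1 and
    sum_i b x_i (x) y_i = sum_i x_i (x) y_i b for all b; then
    u = sum_i s1(x_i) s2(y_i) is a solution. In general this is done modulo an
    open ideal I (conjugator_mod_open_ideal). As s1 and s2 are continuous
    (retraction_continuous), they induce morphisms to A / I from a
    finite-dimensional quotient D of A / J. For fixed I the solutions u form an
    affine subspace, and A is linearly compact (linear_compactness): the
    solution sets for all I have a common adherent point, which is a solution
    (conjugator_exists).

    There remains the separability element of D (separability_element). Since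
    (A / J) (x)_k E is topologically semisimple, D (x)_k E is von Neumann regular
    for every finite extension E of k (image_regular_ext). Among all E, take a
    decomposition of 1 into nonzero orthogonal idempotents e_i of D (x)_k E that
    is of maximal length. Its corners e_i (D (x) E) e_i are reduced to E e_i
    (split_decomp_exists): a nonscalar element would have an eigenvalue in a
    larger extension and would there split e_i further. Regularity then makes
    every nonzero element of e_i (D (x) E) e_j invertible, which gives matrix
    units and the usual separability element over E (ext_separability); a
    k-linear form E -> k with value 1 at 1 maps it to one over k. *)

Set Implicit Arguments.
Unset Strict Implicit.
Unset Printing Implicit Defensive.

Import GRing.Theory.

Local Open Scope classical_set_scope.
Local Open Scope ring_scope.

(** * Field extensions and scalar extension of matrix algebras *)

Lemma ex_maxnatP (P : nat -> Prop) (b : nat) : (exists m, P m) ->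
  (forall m, P m -> (m <= b)%N) ->
  exists m, P m /\ forall m', P m' -> (m' <= m)%N.
Proof.
move=> exP Pb.
have exP' : exists m, `[< P m >] by case: exP => m Pm; exists m; exact/asboolP.
have Pb' m : `[< P m >] -> (m <= b)%N by move=> /asboolP; exact: Pb.
case: (ex_maxnP exP' Pb') => m /asboolP Pm mmax.
by exists m; split=> // m' Pm'; apply: mmax; exact/asboolP.
Qed.

Lemma ex_minnatP (P : nat -> Prop) : (exists m, P m) ->
  exists m, P m /\ forall m', P m' -> (m <= m')%N.
Proof.
move=> exP.
have exP' : exists m, `[< P m >] by case: exP => m Pm; exists m; exact/asboolP.
case: (ex_minnP exP') => m /asboolP Pm mmin.
by exists m; split=> // m' Pm'; apply: mmin; exact/asboolP.
Qed.

Lemma irreducible_factor (F : fieldType) (p : {poly F}) : (1 < size p)%N ->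
  exists2 q, irreducible_poly q & q %| p.
Proof.
move=> p1.
have [|m [[q q1 [qp mq]] qmin]] := @ex_minnatP
  (fun m => exists2 q : {poly F}, (1 < size q)%N & (q %| p) /\ m = size q).
  by exists (size p), p.
exists q => //; split=> // r r1 rq.
have q0 : q != 0 by rewrite -size_poly_gt0 (leq_trans _ q1).
have r0 : r != 0 by apply: contraTneq rq => ->; rewrite dvd0p.
rewrite -dvdp_size_eqp // eqn_leq dvdp_leq //= -mq; apply: qmin.
exists r; last by split=> //; exact: dvdp_trans qp.
by rewrite ltn_neqAle eq_sym r1 size_poly_gt0.
Qed.

(** A polynomial over a finite extension of k has a root in a larger finite
    extension of k; the embedding g is k-linear. *)
Lemma root_extension (k : fieldType) (E : fieldExtType k) (p : {poly E}) :
  (1 < size p)%N ->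
  exists (L : fieldExtType k) (g : {rmorphism E -> L}) (x : L),
    (forall (c : k) u, g (c *: u) = c *: g u) /\ root (map_poly g p) x.
Proof.
move=> /irreducible_factor[q /irredp_FAdjoin[L _ [z qz _]] qp].
exists (baseFieldType L), (GRing.in_alg L : {rmorphism E -> baseFieldType L}), z.
split.
  by move=> c u; rewrite baseField_scaleE /= scalerA mulr_algl.
by apply: (root_dvdp _ qz); rewrite dvdp_map.
Qed.

Section ScalarExtension.
Variables (k : fieldType) (n : nat) (D : 'M[k]_n -> Prop).

(** D is a unital subalgebra of the matrices over k. *)
Definition mx_subalgebra := [/\ D 1%:M,
  forall c X Y, D X -> D Y -> D (c *: X + Y) &
  forall X Y, D X -> D Y -> D (X *m Y)].

(** Membership in the scalar extension of D to E, as a set of matrices over E: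
    every k-linear form on E, applied entrywise, gives a matrix of D. Since D
    is a subspace, this says that the coordinates of X along a basis of E over
    k lie in D; the choice of a basis is avoided. *)
Definition ext_mx (E : fieldExtType k) (X : 'M[E]_n) :=
  forall l : {scalar E}, D (map_mx l X).

(** The scalar extension of D to E is von Neumann regular. *)
Definition regular_ext (E : fieldExtType k) := forall X : 'M[E]_n,
  ext_mx X -> exists2 Y, ext_mx Y & X *m Y *m X = X.

Hypothesis sD : mx_subalgebra.

Lemma mx_subalgebra0 : D 0.
Proof.
by case: sD => D1 DD _; rewrite -(subrr 1%:M) addrC -scaleN1r; exact: DD.
Qed.

Lemma mx_subalgebraZ c X : D X -> D (c *: X).
Proof.
by case: sD => _ DD _ DX; rewrite -[_ *: X]addr0; apply: DD => //; exact: mx_subalgebra0.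
Qed.

Lemma mx_subalgebraD X Y : D X -> D Y -> D (X + Y).
Proof. by case: sD => _ DD _ DX DY; rewrite -[X]scale1r; exact: DD. Qed.

Lemma mx_subalgebra_sum (I : Type) (r : seq I) (P : pred I) (f : I -> 'M[k]_n) :
  (forall i, P i -> D (f i)) -> D (\sum_(i <- r | P i) f i).
Proof.
move=> Df; apply: (big_ind D) => //; first exact: mx_subalgebra0.
exact: mx_subalgebraD.
Qed.

Variable E : fieldExtType k.
Implicit Types X Y : 'M[E]_n.
Local Notation e := (vbasis {:E}).
Local Notation f := (in_alg E).

Lemma mx_coord_sum m p (X : 'M[E]_(m, p)) :
  X = \sum_(i < \dim {:E}) e`_i *: map_mx f (map_mx (coord e i) X).
Proof.
apply/matrixP => a b; rewrite summxE {1}(coord_vbasis (memvf (X a b))).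
by apply: eq_bigr => i _; rewrite !mxE mulrC mulr_algl.
Qed.

Lemma map_scalar_mx (l : {scalar E}) m p (u : E) (M : 'M[k]_(m, p)) :
  map_mx l (u *: map_mx f M) = l u *: M.
Proof. by apply/matrixP => a b; rewrite !mxE mulrC mulr_algl linearZ /= mulrC. Qed.

Lemma map_scalar_mul (l : {scalar E}) m p q r (X : 'M[E]_(m, p))
    (Z : 'M[k]_(p, q)) (Y : 'M[E]_(q, r)) :
  map_mx l (X *m map_mx f Z *m Y) =
    \sum_(i < \dim {:E}) \sum_(j < \dim {:E}) l (e`_i * e`_j) *:
      (map_mx (coord e i) X *m Z *m map_mx (coord e j) Y).
Proof.
rewrite [in LHS](mx_coord_sum X) [in LHS](mx_coord_sum Y) !mulmx_suml raddf_sum.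
apply: eq_bigr => i _; rewrite mulmx_sumr raddf_sum; apply: eq_bigr => j _.
rewrite -!scalemxAl -!scalemxAr scalerA -!map_mxM.
exact: (map_scalar_mx l (e`_i * e`_j)).
Qed.

Lemma ext_mxD X Y : ext_mx X -> ext_mx Y -> ext_mx (X + Y).
Proof. by move=> DX DY l; rewrite map_mxD; exact (mx_subalgebraD (DX l) (DY l)). Qed.

Lemma ext_mxZ a X : ext_mx X -> ext_mx (a *: X).
Proof.
move=> DX l.
have la : scalar (fun u => l (a * u)).
  by move=> c u v; rewrite /= mulrDr -scalerAr linearP.
pose l' : {scalar E} := HB.pack (fun u => l (a * u)) (GRing.isLinear.Build _ _ _ _ _ la).
suff -> : map_mx l (a *: X) = map_mx l' X by exact: DX.
by apply/matrixP => i j; rewrite !mxE.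
Qed.

Lemma ext_mxB X Y : ext_mx X -> ext_mx Y -> ext_mx (X - Y).
Proof. by move=> DX DY; rewrite -scaleN1r; apply: ext_mxD => //; exact: ext_mxZ. Qed.

Lemma ext_mx1 : @ext_mx E 1%:M.
Proof.
move=> l; suff -> : map_mx l 1%:M = l 1 *: (1%:M : 'M_n).
  by apply: mx_subalgebraZ; case: sD.
by rewrite -map_scalar_mx map_mx1 scale1r.
Qed.

Lemma ext_mxM X Y : ext_mx X -> ext_mx Y -> ext_mx (X *m Y).
Proof.
move=> DX DY l.
have -> : X *m Y = X *m map_mx f 1%:M *m Y by rewrite map_mx1 mulmx1.
rewrite map_scalar_mul; apply: mx_subalgebra_sum => i _.
apply: mx_subalgebra_sum => j _; apply: mx_subalgebraZ; rewrite mulmx1.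
by case: sD => _ _; apply; [exact: DX | exact: DY].
Qed.

(** Membership in the scalar extension is preserved by enlarging E. *)
Lemma ext_mx_map (L : fieldExtType k) (g : {rmorphism E -> L}) X :
  (forall (c : k) u, g (c *: u) = c *: g u) -> ext_mx X ->
  forall l : {scalar L}, D (map_mx l (map_mx g X)).
Proof.
move=> gZ DX l.
have lg : scalar (l \o g).
  by move=> c u v; rewrite /= rmorphD [g (c *: u)]gZ linearP.
pose l' : {scalar E} := HB.pack (l \o g) (GRing.isLinear.Build _ _ _ _ _ lg).
suff -> : map_mx l (map_mx g X) = map_mx l' X by exact: DX.
by apply/matrixP => i j; rewrite !mxE.
Qed.

End ScalarExtension.

(** * Orthogonal idempotents *)

Lemma row_free_kernel0 (F : fieldType) m n (A : 'M[F]_(m, n)) :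
  (forall c : 'rV_m, c *m A = 0 -> c = 0) -> row_free A.
Proof.
move=> A0; rewrite -kermx_eq0 -nz_row_eq0; apply/eqP; apply: A0.
by apply/sub_kermxP; exact: nz_row_sub.
Qed.

Lemma sum_option (V : nmodType) (L : finType) (F : option L -> V) :
  \sum_o F o = F None + \sum_i F (Some i).
Proof.
rewrite (bigD1 None) //=; congr (_ + _).
rewrite (reindex_omap Some id) /=; last by case.
by apply: eq_bigl => i; rewrite eqxx.
Qed.

Section Idempotents.
Variables (k : fieldType) (n : nat) (D : 'M[k]_n -> Prop).
Hypothesis sD : mx_subalgebra D.

(** A decomposition of 1 into nonzero orthogonal idempotents of the scalar
    extension of D to E. *)
Definition idem_decomp (E : fieldExtType k) (L : finType) (e : L -> 'M[E]_n) :=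
  [/\ forall i, ext_mx D (e i), forall i, e i != 0,
      forall i j, e i *m e j = if i == j then e i else 0 & \sum_i e i = 1%:M].

Section Decomposition.
Variables (E : fieldExtType k) (L : finType) (e : L -> 'M[E]_n).
Hypothesis de : idem_decomp e.

Let eD i : ext_mx D (e i). Proof. by case: de. Qed.
Let e0 i : e i != 0. Proof. by case: de. Qed.
Let ee i j : e i *m e j = if i == j then e i else 0. Proof. by case: de. Qed.
Let e1 : \sum_i e i = 1%:M. Proof. by case: de. Qed.
Let eii i : e i *m e i = e i. Proof. by rewrite ee eqxx. Qed.
Let eN i j : i != j -> e i *m e j = 0. Proof. by rewrite ee => /negbTE->. Qed.

Lemma idem_decomp_card : (#|L| <= n)%N.
Proof.
(* Nonzero rows of the e i are linearly independent: e j kills all but one. *)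
pose v i := nz_row (e i).
have v0 i : v i != 0 by rewrite nz_row_eq0.
have vE i : exists w, v i = w *m e i by apply/submxP; exact: nz_row_sub.
have ve i j : v i *m e j = if i == j then v i else 0.
  have [w ->] := vE i; rewrite -mulmxA ee; case: eqP => // _.
  by rewrite mulmx0.
pose V : 'M_(#|L|, n) := \matrix_(i < #|L|) v (enum_val i).
suff /eqP <- : row_free V by exact: rank_leq_col.
apply: row_free_kernel0 => c cV; apply/rowP => j; rewrite mxE.
have : c *m V *m e (enum_val j) = 0 by rewrite cV mul0mx.
rewrite [c *m V]mulmx_sum_row mulmx_suml (bigD1 j) //= big1 ?addr0; last first.
  move=> i ij; rewrite rowK -scalemxAl ve (inj_eq enum_val_inj) (negbTE ij).
  by rewrite scaler0.
rewrite rowK -scalemxAl ve eqxx => /eqP.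
by rewrite scaler_eq0 (negbTE (v0 _)) orbF => /eqP.
Qed.

(** A nontrivial idempotent f of the corner of e i splits e i into f and
    e i - f, which gives a longer decomposition. *)
Lemma idem_decomp_split (i : L) f : ext_mx D f -> f *m f = f ->
  e i *m f = f -> f *m e i = f -> f != 0 -> f != e i ->
  exists (L' : finType) (e' : L' -> 'M[E]_n), #|L'| = #|L|.+1 /\ idem_decomp e'.
Proof.
move=> fD ff ef fe f0 fi.
have fe0 j : i != j -> f *m e j = 0 by move=> ij; rewrite -fe -mulmxA eN ?mulmx0.
have ef0 j : i != j -> e j *m f = 0.
  by move=> ij; rewrite -ef mulmxA eN ?mul0mx // eq_sym.
pose e' (o : option L) := if o is Some j then if j == i then e i - f else e j else f.
exists (option L), e'; split; first by rewrite card_option.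
split=> [[j|]|[j|]|[j|] [l|]|] //=.
- by case: (j =P i) => // _; exact: ext_mxB.
- by case: (j =P i) => // _; rewrite subr_eq0 eq_sym.
- rewrite -[Some j == Some l]/(j == l).
  case: (j =P i) => [->|/eqP ji]; case: (l =P i) => [->|/eqP li].
  + by rewrite eqxx mulmxBl !mulmxBr eii ef fe ff subrr subr0.
  + by rewrite eq_sym (negbTE li) mulmxBl eN 1?eq_sym // fe0 1?eq_sym // subrr.
  + by rewrite (negbTE ji) mulmxBr eN // ef0 1?eq_sym // subrr.
  + by rewrite ee.
- case: (j =P i) => [_|/eqP ji]; first by rewrite mulmxBl ef ff subrr.
  by rewrite ef0 // eq_sym.
- case: (l =P i) => [_|/eqP li]; first by rewrite mulmxBr fe ff subrr.
  by rewrite fe0 // eq_sym.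
rewrite sum_option /= (bigD1 i) //= eqxx addrCA addrA subrK -e1.
rewrite [RHS](bigD1 i) //=; congr (_ + _); apply: eq_bigr => j /negbTE -> //.
Qed.

End Decomposition.
End Idempotents.

(** An element x of the corner of a nonzero idempotent e has, over any field
    where a certain nonconstant polynomial has a root, an eigenvector fixed by
    e: the polynomial is the characteristic polynomial of the action of x on
    the row space of e. *)
Lemma corner_eigenvector (F : fieldType) n (e x : 'M[F]_n) :
  e *m e = e -> e != 0 -> e *m x *m e = x ->
  exists2 p : {poly F}, (1 < size p)%N &
    forall (L : fieldType) (g : {rmorphism F -> L}) (a : L),
      root (map_poly g p) a -> exists v : 'rV_n,
        [/\ v != 0, v *m map_mx g e = v & v *m map_mx g x = a *: v].
Proof.
move=> ee e0 exe.
have [r [B [C [CB fB fC r0]]]] : exists r (B : 'M_(r, n)) (C : 'M_(n, r)),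
    [/\ C *m B = e, row_free B, row_full C & (0 < r)%N].
  exists (\rank e), (row_base e), (col_base e); split.
  - exact: mulmx_base.
  - exact: row_base_free.
  - exact: col_base_full.
  - by rewrite lt0n mxrank_eq0.
have BC : B *m C = 1%:M.
  apply: (row_free_inj fB); apply: (row_full_inj fC).
  by rewrite mul1mx !mulmxA CB -mulmxA CB.
have Bx : B *m x = B *m x *m C *m B by rewrite -[RHS]mulmxA CB -mulmxA -exe -!mulmxA ee.
exists (char_poly (B *m x *m C)).
  by rewrite size_char_poly.
move=> L g a; rewrite map_char_poly -eigenvalue_root_char => /eigenvalueP[w wx w0].
exists (w *m map_mx g B).
have freeB : row_free (map_mx g B) by rewrite row_free_map.
split.
- by apply: contraNneq w0 => wB; apply/eqP; apply: (row_free_inj freeB); rewrite mul0mx.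
- rewrite -mulmxA -map_mxM -CB [B *m _]mulmxA BC mul1mx //.
- by rewrite -mulmxA -map_mxM Bx map_mxM mulmxA wx -scalemxAl.
Qed.

Section Split.
Variables (k : fieldType) (n : nat) (D : 'M[k]_n -> Prop).
Hypothesis sD : mx_subalgebra D.
Hypothesis regD : forall E : fieldExtType k, regular_ext D E.

(** A decomposition whose corners are reduced to the scalars. *)
Definition split_decomp (E : fieldExtType k) (L : finType) (e : L -> 'M[E]_n) :=
  idem_decomp D e /\ forall i X, ext_mx D X -> e i *m X *m e i = X ->
    exists c, X = c *: e i.

Lemma idem_decomp_map (E F : fieldExtType k) (g : {rmorphism E -> F})
    (L : finType) (e : L -> 'M[E]_n) : (forall (c : k) u, g (c *: u) = c *: g u) ->
  idem_decomp D e -> idem_decomp D (fun i => map_mx g (e i)).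
Proof.
move=> gZ [eD e0 ee e1]; split=> [i|i|i j|].
- exact: ext_mx_map.
- by rewrite map_mx_eq0.
- by rewrite -map_mxM ee; case: eqP => // _; rewrite map_mx0.
- by rewrite -(map_mx1 g) -e1 raddf_sum.
Qed.

(** A decomposition of maximal length, among all finite extensions of k, is
    split: an eigenvalue a of an element X of the corner of e i exists after a
    further extension, where X - a e i is not invertible in the corner. By
    regularity it generates an idempotent of the corner other than e i, which
    is 0 by maximality. *)
Lemma split_decomp_exists : exists (E : fieldExtType k) (L : finType)
  (e : L -> 'M[E]_n), split_decomp e.
Proof.
have [||m [[E [L [e [Lm de]]]] mmax]] := @ex_maxnatP (fun m =>
  exists (E : fieldExtType k) (L : finType) (e : L -> 'M[E]_n),
    #|L| = m /\ idem_decomp D e) n.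
- have [I0|I0] := eqVneq (1%:M : 'M[k^o]_n) 0.
    exists 0%N, k^o, void, (fun=> 0); split; first by rewrite card_void.
    by split=> [[]|[]|[]|] //; rewrite I0 big1 //; case.
  exists 1%N, k^o, unit, (fun=> 1%:M); split; first by rewrite card_unit.
  split=> // [_|[] []|]; [exact: (ext_mx1 sD)|by rewrite mul1mx|].
  by rewrite (big_pred1 tt) //; case.
- by move=> m [E [L [e [<- de]]]]; exact: idem_decomp_card de.
exists E, L, e; split=> // i X XD eXe; have [eD e0 ee e1] := de.
have eii : e i *m e i = e i by rewrite ee eqxx.
have [p p1 pP] := corner_eigenvector eii (e0 i) eXe.
have [F [g [a [gZ pa]]]] := root_extension p1.
have [v [v0 ve vX]] := pP _ _ _ pa.
have de' := idem_decomp_map gZ de.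
have [eD' e0' ee' e1'] := de'.
set e' := map_mx g (e i); set X' := map_mx g X.
have eii' : e' *m e' = e' by rewrite -map_mxM eii.
have [XD' eXe'] : ext_mx D X' /\ e' *m X' *m e' = X'.
  by split; [exact: ext_mx_map | rewrite -!map_mxM eXe].
have [eX Xe] : e' *m X' = X' /\ X' *m e' = X'.
  by rewrite -[in X in X /\ _]eXe' -[in X in _ /\ X]eXe' -!mulmxA eii' !mulmxA eii'.
pose z := X' - a *: e'.
have zD : ext_mx D z.
  by apply: (ext_mxB sD) => //; exact (ext_mxZ a (eD' i)).
have ez : e' *m z = z by rewrite mulmxBr eX -scalemxAr eii'.
have ze : z *m e' = z by rewrite mulmxBl Xe -scalemxAl eii'.
have vz : v *m z = 0 by rewrite mulmxBr vX -scalemxAr ve subrr.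
have [z0|z0] := eqVneq z 0; last first.
  (* z y e' is idempotent and nonzero, and differs from e' as v z = 0. *)
  have [y yD zyz] := regD zD.
  have zyez : z *m y *m e' *m z = z by rewrite -[_ *m e' *m z]mulmxA ez.
  have [||||||L' [e'' [L'E de'']]] := idem_decomp_split sD de' (i := i) (f := z *m y *m e').
  - by apply: (ext_mxM sD); [exact: (ext_mxM sD)|exact: (eD' i)].
  - by rewrite !mulmxA zyez.
  - by rewrite !mulmxA ez.
  - by rewrite -mulmxA eii'.
  - by apply: contraNneq z0 => zy0; rewrite -zyez zy0 mul0mx.
  - by apply: contraNneq v0 => zye; rewrite -ve -zye !mulmxA vz !mul0mx.
  have : (m.+1 <= m)%N by apply: mmax; exists F, L', e''; rewrite L'E Lm.
  by rewrite ltnn.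
(* X = a e' with X and e' defined over E, hence so is the scalar a. *)
have [r [s ers]] : exists r s, e i r s != 0.
  apply: contrapT => H; move/eqP: (e0 i); apply; apply/matrixP => r s; rewrite mxE.
  by apply: contrapT => /eqP ers; apply: H; exists r, s.
have Xa : X' = a *: e' by apply/eqP; rewrite -subr_eq0 -/z z0.
exists (X r s / e i r s); apply: (map_mx_inj (f := g)); rewrite map_mxZ -/X' -/e' Xa.
congr (_ *: _); move/matrixP/(_ r s): Xa; rewrite !mxE rmorphM fmorphV => ->.
by rewrite mulfK // fmorph_eq0.
Qed.

End Split.

(** * Matrix units and the separability element *)

Section MatrixUnits.
Variables (k : fieldType) (n : nat) (D : 'M[k]_n -> Prop).
Hypothesis sD : mx_subalgebra D.
Hypothesis regD : forall E : fieldExtType k, regular_ext D E.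
Variables (E : fieldExtType k) (L : finType) (e : L -> 'M[E]_n).
Hypothesis se : split_decomp D e.

Let eD i : ext_mx D (e i). Proof. by case: se => -[]. Qed.
Let e0 i : e i != 0. Proof. by case: se => -[]. Qed.
Let ee i j : e i *m e j = if i == j then e i else 0. Proof. by case: se => -[]. Qed.
Let e1 : \sum_i e i = 1%:M. Proof. by case: se => -[]. Qed.
Let eii i : e i *m e i = e i. Proof. by rewrite ee eqxx. Qed.
Let eN i j : i != j -> e i *m e j = 0. Proof. by rewrite ee => /negbTE->. Qed.

(** A pair of mutually inverse elements x in e i D e j and y in e j D e i. *)
Definition mx_unit_pair i j (x y : 'M[E]_n) :=
  [/\ ext_mx D x, ext_mx D y, e i *m x = x /\ x *m e j = x,
      e j *m y = y /\ y *m e i = y & x *m y = e i /\ y *m x = e j].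

(** The idempotents e i and e j lie in the same matrix block. *)
Definition linked i j := exists x y, mx_unit_pair i j x y.

(** By regularity, a nonzero element of e i D e j is invertible. *)
Lemma linkedP i j x : ext_mx D x -> e i *m x *m e j != 0 -> linked i j.
Proof.
set z := e i *m x *m e j => xD z0.
have zD : ext_mx D z by do 2![apply: (ext_mxM sD) => //].
have ez : e i *m z = z by rewrite /z !mulmxA eii.
have ze : z *m e j = z by rewrite /z -!mulmxA eii.
clearbody z.
have [y0 y0D zyz0] := regD zD.
have [y [yD ey ye zyz]] : exists y, [/\ ext_mx D y, e j *m y = y, y *m e i = y &
    z *m y *m z = z].
  exists (e j *m y0 *m e i); split.
  - by do 2![apply: (ext_mxM sD) => //].
  - by rewrite !mulmxA eii.
  - by rewrite -!mulmxA eii.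
  - by rewrite !mulmxA ze -[_ *m e i *m z]mulmxA ez.
have corner l X : ext_mx D X -> e l *m X = X -> X *m e l = X -> exists c, X = c *: e l.
  by move=> XD eX Xe; case: se => _; apply => //; rewrite eX.
have scalar1 c : c *: z = z -> c = 1.
  move/eqP; rewrite -subr_eq0 -[X in _ - X]scale1r -scalerBl scaler_eq0 (negbTE z0) orbF.
  by rewrite subr_eq0 => /eqP.
exists z, y; split=> //; split.
- have [||| c zyc] := corner i (z *m y).
  + exact: (ext_mxM sD).
  + by rewrite mulmxA ez.
  + by rewrite -mulmxA ye.
  by rewrite zyc (scalar1 c) ?scale1r // -[RHS]zyz zyc -scalemxAl ez.
- have [||| c yzc] := corner j (y *m z).
  + exact: (ext_mxM sD).
  + by rewrite mulmxA ey.
  + by rewrite -mulmxA ze.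
  by rewrite yzc (scalar1 c) ?scale1r // -[RHS]zyz -mulmxA yzc -scalemxAr ze.
Qed.

Lemma mx_unit_pair_linked i j x y l x' y' : mx_unit_pair i j x y ->
  mx_unit_pair j l x' y' -> linked i l.
Proof.
move=> [xD yD [ex xe] [ey ye] [xy yx]] [xD' yD' [ex' xe'] [ey' ye'] [xy' yx']].
apply: (@linkedP _ _ (x *m x')); first exact: (ext_mxM sD).
rewrite mulmxA ex -mulmxA xe'.
apply: contraNneq (e0 i) => xx.
by rewrite -xy -xe -xy' mulmxA xx !mul0mx.
Qed.

Lemma linked_refl i : linked i i.
Proof. by apply: (@linkedP _ _ (e i)); rewrite ?eii. Qed.

Lemma linked_sym i j : linked i j -> linked j i.
Proof. by move=> [x [y [xD yD ? ? []]]]; exists y, x; split. Qed.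

Lemma linked_trans j i l : linked i j -> linked j l -> linked i l.
Proof. by move=> [x [y xy]] [x' [y' xy']]; exact: mx_unit_pair_linked xy xy'. Qed.

(** A representative of the class of i for the relation linked. *)
Definition link_repr i := odflt i [pick j | `[< linked i j >]].

Lemma link_reprP i : linked i (link_repr i).
Proof.
rewrite /link_repr; case: pickP => [j /asboolP //|/(_ i)].
by move/asboolPn; case; exact: linked_refl.
Qed.

Lemma link_repr_eq i j : linked i j -> link_repr i = link_repr j.
Proof.
move=> ij; rewrite /link_repr.
have E1 : (fun l => `[< linked i l >]) =1 (fun l => `[< linked j l >]).
  move=> l; apply/asboolP/asboolP; last exact: linked_trans.
  exact: linked_trans (linked_sym ij).
rewrite (eq_pick E1); case: pickP => // /(_ i) /asboolPn[].
exact: linked_sym.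
Qed.

(** The separability element of a product of matrix algebras, given by matrix
    units: the sum of the x i (x) y i, where x i and y i are inverse elements
    between e i and the representative of its class. That multiplications by b
    on the far left and on the far right agree on this tensor is expressed by
    inserting an arbitrary matrix Z in the middle. *)
Lemma ext_separability : exists x y : L -> 'M[E]_n,
  [/\ forall i, ext_mx D (x i), forall i, ext_mx D (y i),
      \sum_i x i *m y i = 1%:M &
      forall b, ext_mx D b -> forall Z,
        \sum_i b *m x i *m Z *m y i = \sum_i x i *m Z *m y i *m b].
Proof.
have /choice[xy xyP] : forall i, exists p : 'M[E]_n * 'M[E]_n,
    mx_unit_pair i (link_repr i) p.1 p.2.
  by move=> i; have [x [y]] := link_reprP i; exists (x, y).
pose x i := (xy i).1; pose y i := (xy i).2.
have P i : mx_unit_pair i (link_repr i) (x i) (y i) by exact: xyP.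
exists x, y; split=> [i|i||b bD Z].
- by case: (P i).
- by case: (P i).
- by rewrite -e1; apply: eq_bigr => i _; case: (P i) => _ _ _ _ [].
transitivity (\sum_i \sum_j e j *m b *m x i *m Z *m y i).
  by apply: eq_bigr => i _; rewrite -!mulmx_suml e1 mul1mx.
rewrite exchange_big; apply: eq_bigr => j _ /=.
transitivity (\sum_i x j *m Z *m y j *m (b *m e i)); last first.
  by rewrite -mulmx_sumr -mulmx_sumr e1 mulmx1.
apply: eq_bigr => i _.
have [xiD yiD [exi xei] [eyi yei] [xyi yxi]] := P i.
have [xjD yjD [exj xej] [eyj yej] [xyj yxj]] := P j.
have [b0|b0] := eqVneq (e j *m b *m e i) 0.
  rewrite -[in LHS]exi -[in RHS]yej !mulmxA b0 !mul0mx.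
  by rewrite -[RHS]mulmxA -[RHS]mulmxA [e j *m _]mulmxA b0 mulmx0.
have rji := link_repr_eq (linkedP bD b0).
have [||c cP] := se.2 (link_repr j) (y j *m b *m x i).
- by do 2![apply: (ext_mxM sD) => //].
- by rewrite !mulmxA eyj -mulmxA rji xei.
have -> : e j *m b *m x i = c *: x j.
  by rewrite -xyj -!mulmxA [y j *m _]mulmxA cP -scalemxAr xej.
suff -> : x j *m Z *m y j *m (b *m e i) = x j *m Z *m (c *: y i).
  by rewrite -!scalemxAl -scalemxAr.
rewrite -[LHS]mulmxA; congr (_ *m _).
by rewrite -xyi !mulmxA cP -scalemxAl rji eyi.
Qed.

End MatrixUnits.

Lemma scalar_retraction (k : fieldType) (E : fieldExtType k) :
  exists l : {scalar E}, l 1 = 1.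
Proof.
pose co := coord (vbasis {:E}).
have [i i0] : exists i, co i 1 != 0.
  apply: contrapT => co0; have := oner_neq0 E; rewrite (coord_vbasis (memvf 1)).
  rewrite big1 ?eqxx // => i _; rewrite -/co.
  have [->|ci] := eqVneq (co i 1) 0; first by rewrite scale0r.
  by case: co0; exists i.
have l1 : scalar (fun u => (co i 1)^-1 * co i u).
  by move=> c u v; rewrite /= /co linearP mulrDr mulrCA.
pose l : {scalar E} :=
  HB.pack (fun u => (co i 1)^-1 * co i u) (GRing.isLinear.Build _ _ _ _ _ l1).
by exists l; rewrite /= mulVf.
Qed.

Lemma map_scalar_mulmx (k : fieldType) (E : fieldExtType k) (l : {scalar E})
    m p q r (M : 'M[k]_(m, p)) (X : 'M[E]_(p, q)) (N : 'M[k]_(q, r)) :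
  map_mx l (map_mx (in_alg E) M *m X *m map_mx (in_alg E) N) = M *m map_mx l X *m N.
Proof.
have ll c u : l (c%:A * u) = c * l u by rewrite mulr_algl linearZ.
apply/matrixP => a b; rewrite !mxE raddf_sum; apply: eq_bigr => j _.
rewrite !mxE /= [_ * (N _ _)%:A]mulrC ll mulrC; congr (_ * _).
by rewrite raddf_sum; apply: eq_bigr => i _; rewrite !mxE /= ll.
Qed.

(** An algebra of matrices over k that stays regular after every finite
    extension has a separability element: a linear form on E with value 1 at 1
    sends the one found over an extension E to one over k. *)
Lemma separability_element (k : fieldType) n (D : 'M[k]_n -> Prop) :
  mx_subalgebra D -> (forall E : fieldExtType k, regular_ext D E) ->
  exists (L : finType) (a b : L -> 'M[k]_n),
    [/\ forall i, D (a i), forall i, D (b i), \sum_i a i *m b i = 1%:M &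
      forall c, D c -> forall Z : 'M_n,
        \sum_i c *m a i *m Z *m b i = \sum_i a i *m Z *m b i *m c].
Proof.
move=> sD regD.
have [E [L [e se]]] := split_decomp_exists sD regD.
have [x [y [xD yD xy1 xyc]]] := ext_separability sD regD se.
have [l l1] := scalar_retraction E.
pose v := vbasis {:E}; pose d := \dim {:E}; pose f := in_alg E.
pose a (t : L * ('I_d * 'I_d)) :=
  l (v`_t.2.1 * v`_t.2.2) *: map_mx (coord v t.2.1) (x t.1).
pose b (t : L * ('I_d * 'I_d)) := map_mx (coord v t.2.2) (y t.1).
have abE (Z : 'M[k]_n) : \sum_t a t *m Z *m b t =
    map_mx l (\sum_i x i *m map_mx f Z *m y i).
  rewrite raddf_sum /= -(pair_bigA _ (fun i p => a (i, p) *m Z *m b (i, p))) /=.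
  apply: eq_bigr => i _; rewrite map_scalar_mul.
  rewrite -(pair_bigA _ (fun p q => a (i, (p, q)) *m Z *m b (i, (p, q)))) /=.
  by apply: eq_bigr => p _; apply: eq_bigr => q _; rewrite /a /b /= -!scalemxAl.
have mapD c : D c -> ext_mx D (map_mx f c).
  move=> cD m; suff -> : map_mx m (map_mx f c) = m 1 *: c by exact: mx_subalgebraZ.
  by rewrite -map_scalar_mx scale1r.
exists (L * ('I_d * 'I_d))%type, a, b; split=> [t|t||c cD Z].
- by apply: mx_subalgebraZ => //; exact: xD.
- exact: yD.
- transitivity (\sum_t a t *m 1%:M *m b t).
    by apply: eq_bigr => t _; rewrite mulmx1.
  rewrite abE map_mx1; under eq_bigr do rewrite mulmx1.
  rewrite xy1; have := map_scalar_mx l 1 (1%:M : 'M_n).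
  by rewrite map_mx1 scale1r l1 scale1r.
transitivity (c *m (\sum_t a t *m Z *m b t)).
  by rewrite mulmx_sumr; apply: eq_bigr => t _; rewrite !mulmxA.
rewrite -mulmx_suml abE.
have E1 M : c *m map_mx l M = map_mx l (map_mx f c *m M).
  by have := map_scalar_mulmx l c M 1%:M; rewrite map_mx1 !mulmx1.
have E2 M : map_mx l M *m c = map_mx l (M *m map_mx f c).
  by have := map_scalar_mulmx l 1%:M M c; rewrite map_mx1 !mul1mx.
rewrite E1 E2 mulmx_sumr mulmx_suml; congr (map_mx l _).
rewrite -(xyc _ (mapD c cD) (map_mx f Z)).
by apply: eq_bigr => i _; rewrite !mulmxA.
Qed.

(** * Finite codimension and affine subspaces *)

Lemma subrACA (V : zmodType) (x y z t : V) : x - y - (z - t) = x - z - (y - t).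
Proof. by rewrite !opprB addrACA [- y - z]addrC addrACA. Qed.

Section Codimension.
Variables (k : fieldType) (V : lmodType k).
Implicit Types (I X Y : set V).

Definition subspace I := I 0 /\ forall c x y, I x -> I y -> I (c *: x + y).

(** Translates of linear subspaces. *)
Definition affine X := X !=set0 /\
  forall c x y z, X x -> X y -> X z -> X (x + c *: (y - z)).

(** Generating and independent families modulo I. *)
Definition spans_mod I n (v : 'I_n -> V) :=
  forall a, exists c : 'I_n -> k, I (a - \sum_i c i *: v i).

Definition free_mod I n (v : 'I_n -> V) :=
  forall c : 'I_n -> k, I (\sum_i c i *: v i) -> forall i, c i = 0.

Section Subspace.
Variable I : set V.
Hypothesis sI : subspace I.

Lemma subspace0 : I 0. Proof. by case: sI. Qed.

Lemma subspaceD x y : I x -> I y -> I (x + y).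
Proof. by case: sI => _ Il Ix Iy; rewrite -[x]scale1r; exact: Il. Qed.

Lemma subspaceZ c x : I x -> I (c *: x).
Proof. by case: sI => I0 Il Ix; rewrite -[_ *: _]addr0; exact: Il. Qed.

Lemma subspaceN x : I x -> I (- x).
Proof. by move=> Ix; rewrite -scaleN1r; exact: subspaceZ. Qed.

Lemma subspaceB x y : I x -> I y -> I (x - y).
Proof. by move=> Ix Iy; apply: subspaceD => //; exact: subspaceN. Qed.

Lemma subspace_sum (T : Type) (r : seq T) (f : T -> V) :
  (forall i, I (f i)) -> I (\sum_(i <- r) f i).
Proof.
by move=> If; apply: (big_ind I) => //; [exact: subspace0 | exact: subspaceD].
Qed.

Lemma free_mod_leq n (w : 'I_n -> V) m (v : 'I_m -> V) :
  spans_mod I w -> free_mod I v -> (m <= n)%N.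
Proof.
move=> Iw Iv; have /choice[C CP] : forall i, exists c : 'I_n -> k,
  I (v i - \sum_j c j *: w j) by move=> i; exact: Iw.
pose M : 'M_(m, n) := \matrix_(i, j) C i j.
suff /eqP <- : row_free M by exact: rank_leq_col.
apply: row_free_kernel0 => c cM; apply/rowP => i; rewrite mxE.
apply: (Iv (fun i => c 0 i)).
have -> : \sum_i c 0 i *: v i = \sum_i c 0 i *: (v i - \sum_j C i j *: w j).
  rewrite [RHS](eq_bigr (fun i => c 0 i *: v i - c 0 i *: \sum_j C i j *: w j)); last first.
    by move=> l _; rewrite scalerBr.
  rewrite sumrB [X in _ - X](_ : _ = 0) ?subr0 //.
  transitivity (\sum_j (c *m M) 0 j *: w j); last first.
    by rewrite cM big1 // => j _; rewrite mxE scale0r.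
  under eq_bigr do rewrite scaler_sumr.
  rewrite exchange_big; apply: eq_bigr => j _; rewrite mxE scaler_suml.
  by apply: eq_bigr => l _; rewrite mxE scalerA.
by apply: subspace_sum => l; exact: subspaceZ.
Qed.

Lemma free_mod_cons n (v : 'I_n -> V) x : free_mod I v ->
  (forall c : 'I_n -> k, ~ I (x - \sum_i c i *: v i)) ->
  free_mod I (fun i => if unlift ord0 i is Some j then v j else x).
Proof.
move=> Iv Ix c; rewrite big_ord_recl unlift_none.
under eq_bigr do rewrite liftK.
move=> Ic; have c0 : c ord0 = 0.
  apply: contrapT => /eqP c0; apply: (Ix (fun i => - (c ord0)^-1 * c (lift ord0 i))).
  have := subspaceZ (c ord0)^-1 Ic; rewrite scalerDr scalerA mulVf // scale1r.
  congr (I (_ + _)); rewrite -sumrN scaler_sumr; apply: eq_bigr => i _.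
  by rewrite scalerA mulNr scaleNr opprK.
move: Ic; rewrite c0 scale0r add0r => /Iv cl i.
by case: (unliftP ord0 i) => [j|] ->.
Qed.

Lemma finite_codim_basis n (w : 'I_n -> V) : spans_mod I w ->
  exists m (v : 'I_m -> V), spans_mod I v /\ free_mod I v.
Proof.
move=> Iw.
have [||m [[v Iv] mmax]] := @ex_maxnatP (fun m => exists v : 'I_m -> V, free_mod I v) n.
- by exists 0%N, (fun=> 0) => c _ [].
- by move=> m [v]; exact: free_mod_leq.
exists m, v; split=> // a; apply: contrapT => na.
have : (m.+1 <= m)%N; last by rewrite ltnn.
apply: mmax; eexists; apply: (@free_mod_cons _ _ a Iv) => c Ic.
by apply: na; exists c.
Qed.

(** In a family of affine subspaces closed under intersection, some member has
    a smallest image modulo a subspace of finite codimension: one that spans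
    the fewest independent directions. *)
Lemma affine_stable n (w : 'I_n -> V) (F : set (set V)) : spans_mod I w ->
  F !=set0 -> (forall X, F X -> affine X) ->
  (forall X Y, F X -> F Y -> F (X `&` Y)) ->
  exists X, F X /\ forall Y, F Y -> forall x, X x -> exists2 y, Y y & I (x - y).
Proof.
move=> Iw [X0 FX0] Faff FI.
pose P X m := exists x (v : 'I_m -> V),
  [/\ X x, forall i, X (x + v i) & free_mod I v].
have [|m [[X FX nXm] mmin]] := @ex_minnatP (fun m => exists2 X, F X & ~ P X m.+1).
  exists n, X0 => // -[x [v [_ _ /(free_mod_leq Iw)]]].
  by rewrite ltnn.
have Pm Y : F Y -> P Y m.
  move=> FY; case: m mmin {nXm} => [|m] mmin.
    have [[y Yy] _] := Faff _ FY.
    by exists y, (fun=> 0); split=> //; [case|move=> c _ []].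
  apply: contrapT => nYm; have := mmin m; rewrite ltnn => H.
  by have /H : exists2 Y, F Y & ~ P Y m.+1 by exists Y.
exists X; split=> // Y FY x Xx.
have [y [v [[Xy Yy] XYv Iv]]] := Pm _ (FI _ _ FX FY).
have [c Ic] : exists c : 'I_m -> k, I (x - y - \sum_i c i *: v i).
  apply: contrapT => nc; apply: nXm.
  exists y, (fun i => if unlift ord0 i is Some j then v j else x - y); split=> //.
    move=> i; case: unlift => [j|]; first by case: (XYv j).
    by rewrite addrC subrK.
  by apply: free_mod_cons => // c Ic; apply: nc; exists c.
exists (y + \sum_i c i *: v i); last by rewrite opprD addrA.
have [_ Yaff] := Faff _ FY.
elim/big_rec: _ => [|i z _ Yz]; first by rewrite addr0.
rewrite addrCA addrC -[v i](addrK y) [v i + y]addrC.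
by apply: Yaff => //; case: (XYv i).
Qed.

End Subspace.

Lemma affineI X Y : affine X -> affine Y -> X `&` Y !=set0 -> affine (X `&` Y).
Proof.
move=> [_ aX] [_ aY] XY; split=> // c x y z [Xx Yx] [Xy Yy] [Xz Yz].
by split; [exact: aX | exact: aY].
Qed.

Lemma affine_coset I v : subspace I -> affine [set a | I (v - a)].
Proof.
move=> sI; split; first by exists v; rewrite /= subrr; exact: subspace0.
move=> c x y z /= Ix Iy Iz; rewrite opprD addrA; apply: subspaceB => //.
apply: subspaceZ => //; rewrite (_ : y - z = (v - z) - (v - y)); first exact: subspaceB.
by rewrite opprB [RHS]addrC addrA subrK.
Qed.

End Codimension.

(** * Linear compactness of pseudocompact algebras *)

Lemma left_ideal_subspace (k : fieldType) (A : topAlgType k) (I : set A) :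
  left_ideal I -> subspace I.
Proof.
move=> [I0 ID IM]; split=> // c x y Ix Iy; apply: ID => //.
by rewrite -mulr_algl; exact: IM.
Qed.

Lemma nbhs_coset (k : fieldType) (A : topAlgType k) (I : set A) (l : A) :
  nbhs 0 I -> nbhs l [set z | I (z - l)].
Proof. by rewrite -(subrr l) => /addr_nbhs. Qed.

Lemma open_left_ideal_closed (k : fieldType) (A : topAlgType k) (I : set A) :
  left_ideal I -> nbhs 0 I -> closed I.
Proof.
move=> /left_ideal_subspace sI nI x clx.
have [y [Iy Iyx]] := clx _ (nbhs_coset x nI).
by rewrite -[x](subKr y); exact: subspaceB.
Qed.

Section Pseudocompact.
Variables (k : fieldType) (A : pseudocompactAlgType k).
Implicit Types (I X Y : set A) (F : set (set A)).

Definition open_ideal I := ideal I /\ nbhs 0 I.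

Lemma open_ideal_subspace I : open_ideal I -> subspace I.
Proof. by move=> [[/left_ideal_subspace]]. Qed.

Lemma open_ideal_exists (U : set A) : nbhs 0 U -> exists2 I, open_ideal I & I `<=` U.
Proof. by move=> /nbhs_ideal[I [? ? ?]]; exists I. Qed.

Lemma open_idealI I I' : open_ideal I -> open_ideal I' -> open_ideal (I `&` I').
Proof.
move=> [[[I0 ID IM] IMr] nI] [[[I0' ID' IM'] IMr'] nI']; split; last exact: filterI.
split; first split; first by [].
- by move=> x y [? ?] [? ?]; split; [exact: ID | exact: ID'].
- by move=> a x [? ?]; split; [exact: IM | exact: IM'].
- by move=> a x [? ?]; split; [exact: IMr | exact: IMr'].
Qed.

Lemma open_ideal_codim I : open_ideal I ->
  exists n (w : 'I_n -> A), spans_mod I w.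
Proof.
move=> [_]; have [B [Bi Bn _]] := @pseudocompact_basis _ A.
rewrite Bn => -[J BJ JI]; have [_ [n [w Jw]]] := Bi _ BJ.
by exists n, w => a; have [c Jc] := Jw a; exists c; exact: JI.
Qed.

Lemma open_ideal_separated (x : A) : (forall I, open_ideal I -> I x) -> x = 0.
Proof.
move=> Ix; have [B [Bi Bn B0]] := @pseudocompact_basis _ A.
suff : (\bigcap_(I in B) I) x by rewrite B0.
move=> I BI; apply: Ix; split; first by case: (Bi _ BI).
by rewrite Bn; exists I.
Qed.

Lemma open_ideal_closure X x : closed X ->
  (forall I, open_ideal I -> exists2 y, X y & I (y - x)) -> X x.
Proof.
move=> cX Xx; apply: cX => U; rewrite -[x in nbhs x]add0r => /addr_nbhs.
move=> /open_ideal_exists[I oI IU]; have [y Xy Iyx] := Xx _ oI.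
by exists y; split=> //; have := IU _ Iyx; rewrite /= subrK.
Qed.

(** Linear compactness: a family of affine subspaces closed under intersection
    has a common adherent point. A maximal such family contains a coset of
    every open ideal, by affine_stable, hence generates a Cauchy filter. *)
Lemma linear_compactness F : (forall X, F X -> affine X) ->
  (forall X Y, F X -> F Y -> F (X `&` Y)) ->
  exists l, forall X, F X -> closure X l.
Proof.
move=> Faff FI.
(* The whole space is added so that the family is not empty. *)
pose F0 : set (set A) := F `|` [set setT].
pose good (H : set (set A)) := (forall X, H X -> affine X) /\
  (forall X Y, H X -> H Y -> H (X `&` Y)).
pose P (G : set (set A)) := good (F0 `|` G).
have goodF0 : good F0.
  split=> [X [/Faff //|->]|X Y [FX|->] [FY|->]].
  - by split; [exists 0 | ].
  - by left; exact: FI.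
  - by rewrite setIT; left.
  - by rewrite setTI; left.
  - by rewrite setTI; right.
have [|G [[Gaff GI] Gmax]] := @Zorn_bigcup _ P.
  move=> C CP Ctot.
  have two X Y : (F0 `|` \bigcup_(G in C) G) X -> (F0 `|` \bigcup_(G in C) G) Y ->
      (F0 X /\ F0 Y) \/ exists G, [/\ C G, (F0 `|` G) X & (F0 `|` G) Y].
    move=> [FX|[G CG GX]] [FY|[H CH HY]]; first by left.
    - by right; exists H; split=> //; [left | right].
    - by right; exists G; split=> //; [right | left].
    - have [GH|HG] := Ctot _ _ CG CH.
        by right; exists H; split=> //; right => //; exact: GH.
      by right; exists G; split=> //; right => //; exact: HG.
  split=> [X CX|X Y CX CY].
    have [[FX _]|[G [CG GX _]]] := two _ _ CX CX; first by case: goodF0 => aF _; exact: aF.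
    by have [aG _] := CP _ CG; exact: aG.
  have [[FX FY]|[G [CG GX GY]]] := two _ _ CX CY.
    by left; case: goodF0 => _ iF; exact: iF.
  have [_ /(_ _ _ GX GY)[FXY|GXY]] := CP _ CG; first by left.
  by right; exists G.
set M := F0 `|` G in Gaff GI.
have MT : M setT by left; right.
have FM X : F X -> M X by move=> FX; left; left.
(* By maximality, M contains a coset of every open ideal. *)
have Mcoset I : open_ideal I -> exists v, M [set a | I (v - a)].
  move=> oI; have sI := open_ideal_subspace oI.
  have [n [w Iw]] := open_ideal_codim oI.
  have [|X [MX Xst]] := affine_stable sI Iw _ Gaff GI; first by exists setT.
  have [[v Xv] _] := Gaff _ MX; exists v.
  set C := [set a | I (v - a)].
  have MC Y : M Y -> Y `&` C !=set0.
    by move=> MY; have [y Yy Ivy] := Xst _ MY _ Xv; exists y.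
  have aC : affine C by exact: affine_coset.
  pose G' := [set Y `&` C | Y in M].
  have : P (G `|` G').
    rewrite /P setUA -/M; split=> [X' [/Gaff //|[Y MY <-]]|].
      by apply: affineI => //; [exact: Gaff | exact: MC].
    move=> Y Z [MY|[Y' MY' <-]] [MZ|[Z' MZ' <-]].
    - by left; exact: GI.
    - by right; exists (Y `&` Z'); [exact: GI | rewrite setIA].
    - by right; exists (Y' `&` Z); [exact: GI | rewrite setIAC].
    - by right; exists (Y' `&` Z'); [exact: GI | rewrite setIACA setIid].
  have [CG|nCG] := pselect (G C); first by move=> _; right.
  move/(Gmax _ _)=> H; exfalso; apply: H; split; first exact: subsetUl.
  move=> GG; apply: nCG; apply: GG; right; exists setT => //.
  by rewrite setTI.
pose FF := filter_from M id.
have FFfilter : ProperFilter FF.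
  apply: filter_from_proper; last by move=> X /Gaff[].
  apply: filter_from_filter; first by exists setT.
  by move=> X Y MX MY; exists (X `&` Y) => //; exact: GI.
have [|l FFl] := @pseudocompact_complete _ A FF FFfilter.
  move=> U nU; have [I oI IU] := open_ideal_exists nU.
  have sI := open_ideal_subspace oI; have [v Mv] := Mcoset I oI.
  exists ([set a | I (v - a)], [set a | I (v - a)]) => /=.
    by split; exists [set a | I (v - a)].
  move=> [x y] [/= Ix Iy]; apply: IU => /=.
  by have := subspaceB sI Iy Ix; rewrite opprB addrC addrA subrK.
exists l => X FX U /FFl[Y MY YU].
have [[x [Xx Yx]] _] := Gaff _ (GI _ _ (FM _ FX) MY).
by exists x; split=> //; exact: YU.
Qed.

End Pseudocompact.

(** * Units congruent to 1 and projections onto complements of the radical *)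

Section JacobsonUnits.
Variables (k : fieldType) (A : pseudocompactAlgType k).
Implicit Types (I L : set A).
Local Notation J := (jacobson A).

Lemma jacobson_subspace : subspace J.
Proof. exact/left_ideal_subspace/jacobson_left_ideal. Qed.

Lemma jacobson_closed : closed J.
Proof. by apply: closed_bigI => M [_ cM _ _]. Qed.

(** A proper open left ideal lies in a maximal closed one: take a proper left
    ideal of least codimension among those containing it. *)
Lemma open_left_ideal_maximal L : left_ideal L -> nbhs 0 L -> ~ L 1 ->
  exists2 M, maximal_closed_left_ideal M & L `<=` M.
Proof.
move=> iL nL L1.
pose P m N := [/\ left_ideal N, L `<=` N, ~ N 1 &
  ~ exists v : 'I_m.+1 -> A, free_mod N v].
have [|m [[N [iN LN N1 nN]] mmin]] := @ex_minnatP (fun m => exists N, P m N).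
  have [I oI IL] := open_ideal_exists nL.
  have [n [w Iw]] := open_ideal_codim oI.
  exists n, L; split=> // -[v Lv].
  suff : (n.+1 <= n)%N by rewrite ltnn.
  apply: (free_mod_leq (left_ideal_subspace iL) _ Lv (w := w)) => a.
  by have [c Ic] := Iw a; exists c; exact: IL.
exists N => //; split=> //.
- by apply: open_left_ideal_closed => //; exact: filterS nL.
- by move=> NT; apply: N1; rewrite NT.
move=> N' iN' _ N'T NN'; apply/seteqP; split=> // x N'x.
have N'1 : ~ N' 1.
  move=> N'1; apply: N'T; rewrite -subTset => z _.
  by case: iN' => _ _ NM; rewrite -[z]mulr1; exact: NM.
have sN := left_ideal_subspace iN; have sN' := left_ideal_subspace iN'.
have [v Nv] : exists v : 'I_m -> A, free_mod N' v.
  case: m mmin {nN} => [|m] mmin; first by exists (fun=> 0) => c _ [].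
  apply: contrapT => nv; have := mmin m; rewrite ltnn => H.
  have /H : exists N, P m N; last by [].
  by exists N'; split=> //; exact: subset_trans NN'.
apply: contrapT => nNx; apply: nN; eexists.
apply: (free_mod_cons sN (v := v) (x := x)) => [c Nc|c Nc].
  by apply: Nv; exact: NN'.
have N'c : N' (\sum_i c i *: v i).
  by have := subspaceB sN' N'x (NN' _ Nc); rewrite opprB addrC subrK.
apply: nNx; move: Nc; rewrite big1 ?subr0 // => i _.
by rewrite (Nv _ N'c) scale0r.
Qed.

(** The equation v (1 - w) = 1 is solvable modulo every open ideal, as a
    proper left ideal containing 1 - w would lie in a maximal one, which also
    contains w. Linear compactness gives a solution. *)
Lemma jacobson_left_inverse w : J w -> exists v, v * (1 - w) = 1.
Proof.
move=> Jw; pose X I := [set v : A | I (v * (1 - w) - 1)].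
have [||l Fl] := @linear_compactness _ A [set Y | exists2 I, open_ideal I & Y = X I].
- move=> _ [I oI ->]; have sI := open_ideal_subspace oI; split; last first.
    move=> c x y z Xx Xy Xz; rewrite /X /= mulrDl addrAC -scalerAl mulrBl.
    apply: (subspaceD sI Xx); apply: (subspaceZ sI).
    have := subspaceB sI Xy Xz.
    by rewrite opprB addrA subrK.
  pose L := [set a * (1 - w) | a in setT].
  have iL : left_ideal L.
    split; first by exists 0 => //; rewrite mul0r.
      by move=> _ _ [a _ <-] [b _ <-]; exists (a + b) => //; rewrite mulrDl.
    by move=> b _ [a _ <-]; exists (b * a) => //; rewrite mulrA.
  pose N := [set x + y | x in L & y in I].
  have [[iI _] nI] := oI.
  have iN : left_ideal N by exact: left_ideal_add.
  have IN : I `<=` N.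
    by move=> y Iy; exists 0; [case: iL | exists y => //; rewrite add0r].
  have Nw : N (1 - w).
    exists (1 - w); first by exists 1 => //; rewrite mul1r.
    by exists 0; [exact: subspace0 | rewrite addr0].
  have [[_ [a _ <-] [y Iy ay]]|N1] := pselect (N 1).
    exists a; rewrite /X /= (_ : a * (1 - w) = 1 - y); last first.
      by rewrite -[X in X - y]ay addrK.
    rewrite addrAC subrr add0r.
    exact: subspaceN.
  have [M mM NM] := open_left_ideal_maximal iN (filterS IN nI) N1.
  have [iM _ MT _] := mM; exfalso; apply: MT; rewrite -subTset => z _.
  have M1 : M 1.
    rewrite -[1](subrK w); apply: (subspaceD (left_ideal_subspace iM)).
      exact: NM.
    exact: Jw.
  by case: iM => _ _ MM; rewrite -[z]mulr1; exact: MM.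
- move=> _ _ [I oI ->] [I' oI' ->]; exists (I `&` I') => //.
  exact: open_idealI.
exists l; apply/eqP; rewrite -subr_eq0; apply/eqP; apply: open_ideal_separated => I oI.
have sI := open_ideal_subspace oI.
have [|y [Xy Iy]] := Fl (X I) _ _ (nbhs_coset l oI.2); first by exists I.
have Iyl : I ((y - l) * (1 - w)) by case: oI => -[_ IM] _; exact: IM.
by have := subspaceB sI Xy Iyl; rewrite mulrBl opprB addrC addrA subrK.
Qed.

Lemma jacobson_unit w : J w -> exists v, (1 - w) * v = 1 /\ v * (1 - w) = 1.
Proof.
move=> Jw; have [v vw] := jacobson_left_inverse Jw.
have [|v' vv] := @jacobson_left_inverse (- (v * w)).
  apply: (subspaceN jacobson_subspace).
  by case: (jacobson_left_ideal A) => _ _; apply.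
exists v; split=> //; have vE : 1 + v * w = v.
  by apply/eqP; rewrite eq_sym -subr_eq -[v in v - _]mulr1 -mulrBr vw.
rewrite opprK vE in vv.
have wE : 1 - w = v' by rewrite -[LHS]mul1r -{1}vv -mulrA vw mulr1.
by rewrite wE.
Qed.

End JacobsonUnits.

Section Retraction.
Variables (k : fieldType) (A : pseudocompactAlgType k) (S : set A).
Local Notation J := (jacobson A).
Hypotheses (algS : subalgebra S) (cS : closed S) (SJ : direct_sum S J).

Lemma subalgebra_subspace : subspace S.
Proof.
case: algS => S1 Sl _; split; last first.
  by move=> c x y Sx Sy; have := Sl c x y; rewrite !inE; apply.
by move: (Sl (-1) 1 1 S1 S1); rewrite inE scaleN1r addNr.
Qed.

Lemma retraction_exists : exists s : A -> A, forall a, S (s a) /\ J (a - s a).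
Proof.
have [_ ST] := SJ.
have /choice[s sP] : forall a, exists x, S x /\ J (a - x); last by exists s.
move=> a; have : [set x + y | x in S & y in J] a by rewrite ST.
by move=> [x Sx [y Jy <-]]; exists x; split=> //; rewrite addrC addKr.
Qed.

Variable s : A -> A.
Hypothesis sP : forall a, S (s a) /\ J (a - s a).

Lemma retraction_uniq a x : S x -> J (a - x) -> s a = x.
Proof.
move=> Sx Jax; have [Ssa Jsa] := sP a; apply/eqP; rewrite -subr_eq0; apply/eqP.
have [SJ0 _] := SJ; suff : (S `&` J) (s a - x) by rewrite SJ0.
split; first exact: (subspaceB subalgebra_subspace).
have := subspaceB (jacobson_subspace A) Jax Jsa.
by rewrite opprB addrC addrA subrK.
Qed.

Lemma retraction_id a : S a -> s a = a.
Proof.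
by move=> Sa; apply: retraction_uniq => //; rewrite subrr; case: (jacobson_subspace A).
Qed.

Lemma retraction_jacobson a : J a -> s a = 0.
Proof.
move=> Ja; apply: retraction_uniq; rewrite ?subr0 //.
by case: subalgebra_subspace.
Qed.

Lemma retraction1 : s 1 = 1.
Proof. by apply: retraction_id; case: algS; rewrite inE. Qed.

Lemma retractionP c x y : s (c *: x + y) = c *: s x + s y.
Proof.
have [[Sx Jx] [Sy Jy]] := (sP x, sP y); apply: retraction_uniq.
  by case: subalgebra_subspace => _; apply.
rewrite opprD addrACA -scalerBr.
by case: (jacobson_subspace A) => _; apply.
Qed.

Lemma retractionM x y : s (x * y) = s x * s y.
Proof.
have [[Sx Jx] [Sy Jy]] := (sP x, sP y); apply: retraction_uniq.
  by case: algS => _ _ /(_ (s x) (s y)); rewrite !inE; apply.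
have -> : x * y - s x * s y = (x - s x) * y + s x * (y - s y).
  by rewrite mulrBl mulrBr addrA subrK.
apply: (subspaceD (jacobson_subspace A)); first exact: jacobson_mulr.
by case: (jacobson_left_ideal A) => _ _; apply.
Qed.

(** The projection s on S along the radical is continuous. For I' an open ideal,
    let V I' be the intersection of S with I' + J. Modulo I, the V I' have a
    smallest image, attained by some V I0. An element of that image lies, by
    linear compactness, in the image of a point of S that is adherent to J,
    that is 0; hence V I0 is contained in I. *)
Lemma retraction_continuous I : open_ideal I ->
  exists2 I0, open_ideal I0 & forall a, I0 a -> I (s a).
Proof.
move=> oI; have sI := open_ideal_subspace oI; have sJ := jacobson_subspace A.
have sS := subalgebra_subspace.
pose V (I' : set A) := [set x | S x /\ exists2 a, I' a & J (x - a)].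
have V0 I' : open_ideal I' -> V I' 0.
  move=> /open_ideal_subspace sI'; split; first exact: subspace0.
  by exists 0; [exact: subspace0 | rewrite subrr; exact: subspace0].
have aV I' : open_ideal I' -> affine (V I').
  move=> oI'; have sI' := open_ideal_subspace oI'.
  split; first by exists 0; exact: V0.
  move=> c x y z [Sx [a Ia Ja]] [Sy [b Ib Jb]] [Sz [d Id Jd]]; split.
    by apply: subspaceD => //; apply: subspaceZ => //; exact: subspaceB.
  exists (a + c *: (b - d)).
    by apply: subspaceD => //; apply: subspaceZ => //; exact: subspaceB.
  have -> : x + c *: (y - z) - (a + c *: (b - d)) = (x - a) + c *: ((y - b) - (z - d)).
    rewrite opprD addrACA -scalerBr; congr (_ + _ *: _).
    exact: subrACA.
  by apply: (subspaceD sJ) => //; apply: (subspaceZ sJ); exact: (subspaceB sJ).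
pose F := [set X | affine X /\ exists2 I', open_ideal I' & V I' `<=` X].
have FV I' : open_ideal I' -> F (V I') by move=> oI'; split; [exact: aV | exists I'].
have FI X Y : F X -> F Y -> F (X `&` Y).
  move=> [aX [I1 oI1 VX]] [aY [I2 oI2 VY]].
  have V12 : V (I1 `&` I2) `<=` X `&` Y.
    move=> x [Sx [a [I1a I2a] Ja]].
    by split; [apply: VX | apply: VY]; split=> //; exists a.
  have o12 := open_idealI oI1 oI2.
  split; last by exists (I1 `&` I2).
  by apply: affineI => //; exists 0; apply: V12; exact: V0.
have [n [w Iw]] := open_ideal_codim oI.
have [||X [[_ [I0 oI0 VX]] Xst]] := affine_stable sI Iw (F := F) _ _ FI.
- by exists (V I); exact: FV.
- by move=> X [].
exists I0 => // a I0a; have [Ssa Jsa] := sP a.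
have Xsa : X (s a).
  by apply: VX; split=> //; exists a => //; rewrite -opprB; exact: (subspaceN sJ).
pose C := [set b | I (s a - b)].
have [||l Fl] := @linear_compactness _ A [set Y `&` C | Y in F].
- move=> _ [Y FY <-]; apply: affineI; [by case: FY|exact: affine_coset|].
  by have [y Yy Iy] := Xst _ FY _ Xsa; exists y.
- move=> _ _ [Y FY <-] [Z FZ <-]; exists (Y `&` Z); first exact: FI.
  by rewrite setIACA setIid.
have Vl I' : open_ideal I' -> exists2 y, V I' y & I' (y - l) /\ I (s a - y).
  move=> oI'; have [|y [[Vy Cy] Iy]] := Fl (V I' `&` C) _ _ (nbhs_coset l oI'.2).
    by exists (V I') => //; exact: FV.
  by exists y.
have Sl : S l.
  apply: open_ideal_closure => // I' oI'.
  by have [y [Sy _] [Iyl _]] := Vl _ oI'; exists y.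
have Jl : J l.
  apply: open_ideal_closure; first exact: jacobson_closed.
  move=> I' oI'; have [y [_ [b Ib Jyb]] [Iyl _]] := Vl _ oI'; exists (y - b) => //.
  by rewrite addrAC; apply: (subspaceB (open_ideal_subspace oI')).
have l0 : l = 0 by case: SJ => SJ0 _; suff : (S `&` J) l by rewrite SJ0.
have [y _ [Iyl Iy]] := Vl _ oI.
by rewrite -[s a](subrK y); apply: subspaceD => //; move: Iyl; rewrite l0 subr0.
Qed.

End Retraction.

(** * Regularity of the finite-dimensional images *)

Section RegularImage.
Variables (k : fieldType) (A : pseudocompactAlgType k) (n : nat).
Variable rho : A -> 'M[k]_n.
Hypotheses (rho1 : rho 1 = 1%:M)
  (rhoP : forall c x y, rho (c *: x + y) = c *: rho x + rho y)
  (rhoM : forall x y, rho (x * y) = rho x *m rho y)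
  (rhoJ : forall x, jacobson A x -> rho x = 0)
  (rho_open : nbhs (0 : A) [set x | rho x = 0]).

Definition image_mx (M : 'M[k]_n) := exists a, rho a = M.

Lemma image_mx_subalgebra : mx_subalgebra image_mx.
Proof.
split; first by exists 1.
  by move=> c _ _ [a <-] [b <-]; exists (c *: a + b); rewrite rhoP.
by move=> _ _ [a <-] [b <-]; exists (a * b); rewrite rhoM.
Qed.

Let rho0 : rho 0 = 0.
Proof. by apply: rhoJ; case: (jacobson_subspace A). Qed.

Local Notation B := (jacobson_quotient A).
Local Notation pi := (@pi_quot k A (jacobson_pred A)).

Let rhoB (b : B) := rho (repr b).

Let rhoB_pi x : rhoB (pi x) = rho x.
Proof.
have /rhoJ : jacobson A (repr (pi x) - x).
  by have := repr_pi_quot (jacobson_pred A) x; rewrite inE.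
rewrite addrC -scaleN1r rhoP scaleN1r => /eqP.
by rewrite addrC subr_eq0 => /eqP.
Qed.

Let rhoBP c x y : rhoB (c *: x + y) = c *: rhoB x + rhoB y.
Proof.
rewrite -[x]pi_quotK -[y]pi_quotK -linearZ -raddfD !rhoB_pi.
exact: rhoP.
Qed.

Let rhoBM x y : rhoB (x * y) = rhoB x *m rhoB y.
Proof. by rewrite -[x]pi_quotK -[y]pi_quotK -rmorphM !rhoB_pi. Qed.

Variable E : fieldExtType k.
Local Notation T := (tensor B E).
Local Notation d := (\dim {:E}).
Local Notation e := (vbasis {:E}).
Local Notation f := (in_alg E).

(* The morphism B (x)_k E -> 'M[E]_n induced by rho. *)
Let Psi (t : T) : 'M[E]_n := \sum_(i < d) e`_i *: map_mx f (rhoB (t 0 i)).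

Let rhoBD x y : rhoB (x + y) = rhoB x + rhoB y.
Proof. by have := rhoBP 1 x y; rewrite !scale1r. Qed.

Let rhoB0 : rhoB 0 = 0.
Proof. by rewrite -(raddf0 pi) rhoB_pi rho0. Qed.

Let rhoBZ c x : rhoB (c *: x) = c *: rhoB x.
Proof. by rewrite -[c *: x]addr0 rhoBP rhoB0 addr0. Qed.

Let PsiD t t' : Psi (t + t') = Psi t + Psi t'.
Proof.
rewrite -big_split; apply: eq_bigr => i _.
by rewrite mxE rhoBD map_mxD scalerDr.
Qed.

Let Psi_tens b u : Psi (tens b u) = u *: map_mx f (rhoB b).
Proof.
rewrite [in RHS](coord_vbasis (memvf u)) scaler_suml; apply: eq_bigr => i _.
by rewrite mxE rhoBZ map_mxZ scalerA mulrC mulr_algl.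
Qed.

Let Psi1 : Psi 1 = 1%:M.
Proof. by rewrite -tens1 Psi_tens scale1r -(rmorph1 pi) rhoB_pi rho1 map_mx1. Qed.

Let PsiM t t' : Psi (t * t') = Psi t *m Psi t'.
Proof.
elim/tensor_ind: t => [b u|x y IH IH']; last by rewrite mulrDl !PsiD IH IH' mulmxDl.
elim/tensor_ind: t' => [c v|x y IH IH']; last by rewrite mulrDr !PsiD IH IH' mulmxDr.
by rewrite tensM !Psi_tens rhoBM map_mxM -scalemxAl -scalemxAr scalerA.
Qed.

Let Psi_ext t : ext_mx image_mx (Psi t).
Proof.
move=> l; rewrite raddf_sum; apply: (mx_subalgebra_sum image_mx_subalgebra) => i _.
rewrite [X in image_mx X]map_scalar_mx; apply: (mx_subalgebraZ image_mx_subalgebra).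
by exists (repr ((t : T) 0 i)).
Qed.

Let Psi_surj X : ext_mx image_mx X -> exists t, X = Psi t.
Proof.
move=> XD; have /choice[a aP] : forall i, exists a, rho a = map_mx (coord e i) X.
  by move=> i; exact: XD.
exists (\row_i pi (a i)); rewrite [LHS]mx_coord_sum; apply: eq_bigr => i _.
by rewrite mxE rhoB_pi aP.
Qed.

(** The left ideal I generated by t and the kernel of Psi is open, hence has a
    complement; writing 1 = s + l accordingly gives t l = 0, and
    X = Psi t = X Y X, where Psi s = Y X. *)
Lemma image_regular_ext : topologically_semisimple T -> regular_ext image_mx E.
Proof.
move=> ssT X /Psi_surj[t ->].
pose I := [set s : T | exists y, Psi s = Psi y *m Psi t].
have iI : left_ideal I.
  split.
  - by exists 0; rewrite -PsiM mul0r.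
  - by move=> s s' [y yE] [y' yE']; exists (y + y'); rewrite !PsiD yE yE' mulmxDl.
  - by move=> a s [y yE]; exists (a * y); rewrite !PsiM yE mulmxA.
have nI : nbhs (0 : T) I.
  have nK : nbhs (0 : B) [set b | rhoB b = 0].
    rewrite -(raddf0 pi); apply: filterS (pi_quot_nbhs _ rho_open).
    by move=> y [x x0 <-] /=; rewrite rhoB_pi.
  have : \forall s \near (0 : T), forall i, rhoB ((s : T) 0 i) = 0.
    apply: (@filter_forall _ _ _ _ (nbhs_filter (0 : T))) => i.
    have nKi : nbhs ((0 : T) 0 i) [set b | rhoB b = 0] by rewrite mxE.
    exact: (@tensor_coord_cts _ B E i (0 : T) _ nKi).
  apply: filterS => s s0; exists 0; rewrite -PsiM mul0r.
  rewrite /Psi !big1 // => i _; first by rewrite mxE rhoB0 map_mx0 scaler0.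
  by rewrite s0 map_mx0 scaler0.
have [L [[_ _ LM] _ [IL0 ILT]]] := ssT I iI (open_left_ideal_closed iI nI).
have [s [y sy] [l Ll sl]] : [set x + y | x in I & y in L] 1 by rewrite ILT.
have sI := left_ideal_subspace iI.
have tl0 : t * l = 0.
  suff : (I `&` L) (t * l) by rewrite IL0.
  split; last exact: LM.
  have -> : t * l = t - t * s by rewrite -[t in t - _]mulr1 -sl mulrDr addrC addKr.
  apply: (subspaceB sI); first by exists 1; rewrite Psi1 mul1mx.
  by case: iI => _ _; apply; exists y.
exists (Psi y); first exact: Psi_ext.
by rewrite -mulmxA -sy -PsiM -[t in RHS]mulr1 -sl mulrDr tl0 addr0.
Qed.

End RegularImage.

(** * Conjugation *)

(** The regular representation of the quotient by an open ideal. *)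
Lemma quotient_representation (k : fieldType) (A : pseudocompactAlgType k)
    (I : set A) : open_ideal I ->
  exists n (tau : A -> 'M[k]_n),
    [/\ tau 1 = 1%:M, forall c x y, tau (c *: x + y) = c *: tau x + tau y,
        forall x y, tau (x * y) = tau x *m tau y &
        forall a, tau a = 0 <-> I a].
Proof.
move=> oI; have sI := open_ideal_subspace oI; have [[[_ _ IM] IMr] _] := oI.
have [m [w Iw]] := open_ideal_codim oI.
have [n [v [Iv fv]]] := finite_codim_basis sI Iw.
have /choice[c cP] : forall a, exists c : 'I_n -> k, I (a - \sum_i c i *: v i) by exact: Iv.
have cE a x : I (a - \sum_i x i *: v i) -> forall i, c a i = x i.
  move=> Iax i; apply/eqP; rewrite -subr_eq0; apply/eqP.
  apply: (fv (fun i => c a i - x i)).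
  rewrite (eq_bigr (fun i => c a i *: v i - x i *: v i)) => [|j _]; last by rewrite scalerBl.
  rewrite sumrB; have := subspaceB sI Iax (cP a).
  by rewrite opprB addrC addrA subrK.
have cI a : I a -> forall i, c a i = 0.
  by move=> Ia; apply: (cE a (fun=> 0)); rewrite big1 ?subr0 // => i _; rewrite scale0r.
have cl s a b i : c (s *: a + b) i = s * c a i + c b i.
  apply: (cE _ (fun i => s * c a i + c b i)).
  rewrite (eq_bigr (fun i => s *: (c a i *: v i) + c b i *: v i)) => [|j _]; last first.
    by rewrite scalerDl scalerA.
  rewrite big_split /= -scaler_sumr opprD addrACA -scalerBr.
  by case: sI => _; apply.
have c0 i : c 0 i = 0 by apply: cI; exact: subspace0.
have cD a b i : c (a + b) i = c a i + c b i by have := cl 1 a b i; rewrite scale1r mul1r.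
have cZ s a i : c (s *: a) i = s * c a i by rewrite -[s *: a]addr0 cl c0 addr0.
have c_sum (s : 'I_n -> k) (b : 'I_n -> A) i :
    c (\sum_j s j *: b j) i = \sum_j s j * c (b j) i.
  rewrite (big_morph (fun a => c a i) (fun a b => cD a b i) (c0 i)).
  by apply: eq_bigr => j _; rewrite cZ.
have cmod a b i : I (a - b) -> c a i = c b i.
  by move=> Iab; rewrite -[a in LHS](subrK b) cD (cI _ Iab) add0r.
pose tau a : 'M[k]_n := \matrix_(i, j) c (a * v j) i.
have tau1 : tau 1 = 1%:M.
  apply/matrixP => i j; rewrite !mxE mul1r; apply: (cE _ (fun i => (i == j)%:R)).
  rewrite (bigD1 j) //= eqxx scale1r big1 ?addr0 ?subrr; first exact: subspace0.
  by move=> l /negbTE ->; rewrite scale0r.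
exists n, tau; split=> // [s x y|x y|a].
- by apply/matrixP => i j; rewrite !mxE mulrDl -scalerAl cl.
- apply/matrixP => i l; rewrite !mxE.
  rewrite (cmod _ (\sum_j c (y * v l) j *: (x * v j)) i).
    by rewrite c_sum; apply: eq_bigr => j _; rewrite !mxE mulrC.
  rewrite (eq_bigr (fun j => x * (c (y * v l) j *: v j))) => [|j _]; last first.
    by rewrite scalerAr.
  by rewrite -mulr_sumr -mulrA -mulrBr; apply: IM; exact: cP.
split=> [ta|Ia]; last by apply/matrixP => i j; rewrite !mxE; apply: cI; exact: IMr.
have Iav j : I (a * v j).
  have := cP (a * v j); rewrite big1 ?subr0 // => i _.
  by move/matrixP/(_ i j): ta; rewrite !mxE => ->; rewrite scale0r.
have := IM a _ (cP 1); rewrite mulrBr mulr1 mulr_sumr => Ia1.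
rewrite -[a](subrK (\sum_i a * (c 1 i *: v i))); apply: subspaceD => //.
by apply: subspace_sum => // i; rewrite -scalerAr; exact: subspaceZ.
Qed.

Section Conjugation.
Variables (k : fieldType) (A : pseudocompactAlgType k) (S1 S2 : set A).
Local Notation J := (jacobson A).
Hypothesis sepA : separable_algebra (jacobson_quotient A).
Hypotheses (algS1 : subalgebra S1) (cS1 : closed S1) (SJ1 : direct_sum S1 J).
Hypotheses (algS2 : subalgebra S2) (cS2 : closed S2) (SJ2 : direct_sum S2 J).
Variables s1 s2 : A -> A.
Hypothesis s1P : forall a, S1 (s1 a) /\ J (a - s1 a).
Hypothesis s2P : forall a, S2 (s2 a) /\ J (a - s2 a).

(** Let tau be the regular representation of A / I. The separability element of
    the image of A under a |-> diag (tau (s1 a), tau (s2 a)), a quotient of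
    A / J, is a sum of x i (x) y i, and u is the sum of the s1 (x i) s2 (y i),
    up to an element of I. *)
Lemma conjugator_mod_open_ideal I : open_ideal I ->
  exists u, J (u - 1) /\ forall a, I (s1 a * u - u * s2 a).
Proof.
move=> oI; have sI := open_ideal_subspace oI; have sJ := jacobson_subspace A.
have [n [tau [tau1 tauP tauM tauI]]] := quotient_representation oI.
have tauD x y : tau (x + y) = tau x + tau y.
  by have := tauP 1 x y; rewrite !scale1r.
have tau0 : tau 0 = 0 by apply: (addrI (tau 0)); rewrite -tauD !addr0.
have tauB x y : tau (x - y) = tau x - tau y.
  by rewrite addrC -scaleN1r tauP scaleN1r addrC.
have tau_sum (L : finType) (F : L -> A) : tau (\sum_i F i) = \sum_i tau (F i).
  exact: (big_morph tau tauD tau0).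
have ur_sum (L : finType) (F : L -> 'M[k]_(n + n)) :
    ursubmx (\sum_i F i) = \sum_i ursubmx (F i).
  by apply/matrixP => i j; rewrite !(mxE, summxE); apply: eq_bigr => l _; rewrite !mxE.
have ul_sum (L : finType) (F : L -> 'M[k]_(n + n)) :
    ulsubmx (\sum_i F i) = \sum_i ulsubmx (F i).
  by apply/matrixP => i j; rewrite !(mxE, summxE); apply: eq_bigr => l _; rewrite !mxE.
pose rho a : 'M[k]_(n + n) := block_mx (tau (s1 a)) 0 0 (tau (s2 a)).
have rho1 : rho 1 = 1%:M.
  rewrite /rho (retraction1 algS1 SJ1 s1P) (retraction1 algS2 SJ2 s2P) tau1.
  by rewrite -scalar_mx_block.
have rhoP c x y : rho (c *: x + y) = c *: rho x + rho y.
  rewrite /rho (retractionP algS1 SJ1 s1P) (retractionP algS2 SJ2 s2P) !tauP.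
  by rewrite scale_block_mx add_block_mx !scaler0 !addr0.
have rhoM x y : rho (x * y) = rho x *m rho y.
  rewrite /rho (retractionM algS1 SJ1 s1P) (retractionM algS2 SJ2 s2P) !tauM.
  by rewrite mulmx_block !mul0mx !mulmx0 !addr0 !add0r.
have rhoJ x : J x -> rho x = 0.
  move=> Jx; rewrite /rho (retraction_jacobson algS1 SJ1 s1P Jx).
  by rewrite (retraction_jacobson algS2 SJ2 s2P Jx) tau0 block_mx0.
have rho_open : nbhs (0 : A) [set x | rho x = 0].
  have [I1 oI1 I1P] := retraction_continuous algS1 cS1 SJ1 s1P oI.
  have [I2 oI2 I2P] := retraction_continuous algS2 cS2 SJ2 s2P oI.
  have [_ nI12] := open_idealI oI1 oI2; apply: filterS nI12 => x [I1x I2x].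
  by rewrite /= /rho !(tauI _).2 ?block_mx0 //; [exact: I2P | exact: I1P].
have regD E : regular_ext (image_mx rho) E by apply: image_regular_ext.
have [L [a [b [aD bD ab1 abc]]]] := separability_element
  (image_mx_subalgebra rho1 rhoP rhoM) regD.
have {aD} /choice[x xP] := aD; have {bD} /choice[y yP] := bD.
pose u := \sum_i s1 (x i) * s2 (y i).
(* This is the upper right block of the identity abc when Z = (0 1; 0 0). *)
have uE c : tau (s1 c * u) = tau (u * s2 c).
  have := abc (rho c) (ex_intro _ c erefl) (block_mx 0 1%:M 0 0).
  under eq_bigr do rewrite -xP -yP.
  under [X in _ = X]eq_bigr do rewrite -xP -yP.
  move/(congr1 (@ursubmx _ n n n n)); rewrite !ur_sum.
  rewrite mulr_sumr mulr_suml !tau_sum => H.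
  transitivity (\sum_i ursubmx (rho c *m rho (x i) *m block_mx 0 1%:M 0 0 *m rho (y i))).
    apply: eq_bigr => i _; rewrite /rho !mulmx_block !mulmx0 !mul0mx !mulmx1 !addr0 !add0r.
    by rewrite block_mxKur !tauM mulmxA.
  rewrite {}H; apply: eq_bigr => i _.
  rewrite /rho !mulmx_block !mulmx0 !mul0mx !mulmx1 !addr0 !add0r.
  by rewrite block_mxKur !tauM.
pose w := \sum_i s1 (x i) * s1 (y i).
have Iw : I (w - 1).
  apply/tauI; rewrite tauB tau1 /w tau_sum; apply/eqP; rewrite subr_eq0; apply/eqP.
  move/(congr1 (@ulsubmx _ n n n n)): ab1; rewrite ul_sum scalar_mx_block block_mxKul => <-.
  apply: eq_bigr => i _; rewrite -xP -yP /rho mulmx_block block_mxKul.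
  by rewrite mulmx0 addr0 tauM.
have Ju : J (u - w).
  rewrite /u /w -sumrB; apply: (subspace_sum sJ) => i; rewrite -mulrBr.
  case: (jacobson_left_ideal A) => _ _; apply.
  rewrite -[s2 _](subrK (y i)) -addrA; apply: (subspaceD sJ); last by case: (s1P (y i)).
  by rewrite -opprB; apply: (subspaceN sJ); case: (s2P (y i)).
exists (u - (w - 1)); split; first by rewrite opprB addrA addrAC addrK.
move=> c; have [[[_ _ IM] IMr] _] := oI.
set t := w - 1 in Iw *; rewrite mulrBr mulrBl subrACA.
apply: subspaceB => //; first by apply/tauI; rewrite tauB uE subrr.
by apply: subspaceB => //; [exact: IM | exact: IMr].
Qed.

Lemma conjugator_exists : exists u, J (u - 1) /\ forall a, s1 a * u = u * s2 a.
Proof.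
have sJ := jacobson_subspace A.
pose X I := [set u | J (u - 1) /\ forall a, I (s1 a * u - u * s2 a)].
have [||l Fl] := @linear_compactness _ A [set Y | exists2 I, open_ideal I & Y = X I].
- move=> _ [I oI ->]; have sI := open_ideal_subspace oI.
  split; first exact: conjugator_mod_open_ideal.
  move=> c x y z [Jx Ix] [Jy Iy] [Jz Iz]; split=> [|a].
    rewrite addrAC; apply: (subspaceD sJ) => //; apply: (subspaceZ sJ).
    by have := subspaceB sJ Jy Jz; rewrite opprB addrA subrK.
  rewrite mulrDr mulrDl opprD addrACA -scalerAr -scalerAl -scalerBr.
  apply: subspaceD => //; apply: subspaceZ => //.
  have := subspaceB sI (Iy a) (Iz a).
  by rewrite mulrBr mulrBl subrACA.
- move=> _ _ [I oI ->] [I' oI' ->]; exists (I `&` I'); first exact: open_idealI.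
  apply/seteqP; split=> u; first by move=> [[Ju Iu] [_ I'u]]; split.
  by move=> [Ju Iu]; split; split=> // a; case: (Iu a).
have Xl I : open_ideal I -> exists2 u, X I u & I (u - l).
  move=> oI; have [|u [Xu Iu]] := Fl (X I) _ _ (nbhs_coset l oI.2); first by exists I.
  by exists u.
exists l; split.
  apply: (open_ideal_closure (@jacobson_closed _ A)) => I oI.
  by have [u [Ju _] Iul] := Xl _ oI; exists (u - 1) => //; rewrite opprB addrA subrK.
move=> a; apply/eqP; rewrite -subr_eq0; apply/eqP; apply: open_ideal_separated => I oI.
have sI := open_ideal_subspace oI; have [[[_ _ IM] IMr] _] := oI.
have [u [_ /(_ a) Iu] Iul] := Xl _ oI.
have -> : s1 a * l - l * s2 a =
    s1 a * u - u * s2 a - (s1 a * (u - l) - (u - l) * s2 a).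
  rewrite mulrBr mulrBl [X in _ = _ - X]subrACA.
  by rewrite subKr.
by apply: subspaceB => //; apply: subspaceB => //; [exact: IM | exact: IMr].
Qed.

End Conjugation.

Theorem theorem4p7 (k : fieldType) (A : pseudocompactAlgType k)
  (S1 S2 : set A) :
  separable_algebra (jacobson_quotient A) ->
  subalgebra S1 -> closed S1 -> direct_sum S1 (jacobson A) ->
  subalgebra S2 -> closed S2 -> direct_sum S2 (jacobson A) ->
  exists w : A, jacobson A w /\
    exists v : A, [/\ (1 - w) * v = 1, v * (1 - w) = 1 &
      S1 = [set (1 - w) * s * v | s in S2]].
Proof.
move=> sepA algS1 cS1 SJ1 algS2 cS2 SJ2.
have [s1 s1P] := retraction_exists SJ1; have [s2 s2P] := retraction_exists SJ2.
have [u [Ju us]] := conjugator_exists sepA algS1 cS1 SJ1 algS2 cS2 SJ2 s1P s2P.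
have Jw : jacobson A (1 - u).
  by rewrite -opprB; exact: (subspaceN (jacobson_subspace A)).
exists (1 - u); split=> //; have [v [uv vu]] := jacobson_unit Jw.
exists v; split=> //; rewrite subKr in uv vu *.
apply/seteqP; split=> [a S1a|_ [a S2a <-]].
  exists (s2 a); first by case: (s2P a).
  by rewrite -us (retraction_id algS1 SJ1 s1P S1a) -mulrA uv mulr1.
rewrite -(retraction_id algS2 SJ2 s2P S2a) -us -mulrA uv mulr1.
by case: (s1P a).
Qed.
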